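(* Let $a,b\in\mathbb{R}$ and $\lambda>0$, and let $(X_n)_{n\ge0}$ be the Markov chain on $\mathbb{N}^2$ with transition matrix $$P\left((i,j),(k,\ell)\right)=\delta_{i\ell}\,\frac{e^{-s_{ij}}s_{ij}^k}{k!},\qquad s_{ij}:=(ai+bj+\lambda)_+,\qquad i,j,k,\ell\in\mathbb{N}.$$ Let $b_c:\mathbb{R}\to\mathbb{R}$ be given by $b_c(a)=1$ if $a\le 0$, $b_c(a)=1-a$ if $a\in(0,2)$, and $b_c(a)=-\frac{a^2}{4}$ if $a\ge 2$. Let $\mathcal{R}=\{(a,b)\in\mathbb{R}^2: b<b_c(a)\}$ and $\mathcal{T}=\{(a,b)\in\mathbb{R}^2: b>b_c(a)\}$. \begin{itemize} \item If $(a,b)\in\mathcal{R}$, then the Markov chain $(X_n)_{n\ge0}$ is geometrically ergodic, i.e., it admits an invariant probability measure $\pi$ and there exists $\beta>1$ such that for every initial state, $$\beta^n\, d_{TV}(\operatorname{Law}(X_n),\pi)\to 0,\qquad n\to\infty.$$ \item If $(a,b)\in\mathcal{T}$, then the Markov chain is transient, i.e., every state is visited a finite number of times almost surely, for every initial state. \end{itemize}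
   Context: $\mathbb{N}=\{0,1,2,\ldots\}$, $(x)_+=\max(0,x)$, $\delta_{i\ell}$ is the Kronecker delta, and $0^0=1$ (so the Poisson distribution with parameter $0$ is the Dirac mass at $0$). $d_{TV}$ denotes total variation distance. In words: from state $(i,j)$ the chain moves to $(k,i)$, where $k$ is Poisson distributed with parameter $s_{ij}$. *)

(* Defs.v *)
From HB Require Import structures.
From mathcomp Require Import all_boot all_order all_algebra.
From mathcomp Require Import all_classical all_reals all_analysis.

Set Implicit Arguments.
Unset Strict Implicit.
Unset Printing Implicit Defensive.

Import Order.TTheory GRing.Theory Num.Theory.
Import numFieldNormedType.Exports.

Local Open Scope classical_set_scope.
Local Open Scope ring_scope.

Definition state : Type := (nat * nat)%type.

Definition rate (R : realType) (a b lambda : R) (x : state) : R :=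
  Num.max 0 (a * x.1%:R + b * x.2%:R + lambda).

(* [poisson_pmf] is not used here: at rate 0 it is 1 for every [k], whereas this
   formula, with [0 ^+ 0 = 1], gives the Dirac mass at 0. *)
Definition transition (R : realType) (a b lambda : R) (x y : state) : R :=
  let s := rate a b lambda x in
  (x.1 == y.2)%:R * (expR (- s) * s ^+ y.1 / (y.1)`!%:R).

Definition bc (R : realType) (a : R) : R :=
  if a <= 0 then 1 else if a < 2 then 1 - a else - (a ^+ 2 / 4).

Definition regionR (R : realType) : set (R * R) := [set u | u.2 < bc u.1].

Definition regionT (R : realType) : set (R * R) := [set u | bc u.1 < u.2].

Section MarkovChain.
Context {R : realType}.

Definition path_event d (Omega : measurableType d)
    (X : nat -> {mfun Omega >-> (nat * nat)%type}) (s : nat -> state) (n : nat)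
  : set Omega := [set w | forall k, (k <= n)%N -> X k w = s k].

(* [Pr] and [X] form a chain with transition matrix [p] started at [x].
   The second conjunct is
     Pr (X_(n+1) = s_(n+1) | X_0 = s_0, ..., X_n = s_n) = p s_n s_(n+1)
   multiplied out; it is trivially true when the conditioning event is null. *)
Definition markov_chain (p : state -> state -> R) (x : state)
    d (Omega : measurableType d) (Pr : probability Omega R)
    (X : nat -> {mfun Omega >-> (nat * nat)%type}) : Prop :=
  Pr (X 0%N @^-1` [set x]) = 1%E /\
  forall (s : nat -> state) (n : nat),
    Pr (path_event X s n.+1) =
    (Pr (path_event X s n) * (p (s n) (s n.+1))%:E)%E.

Definition invariant_measure (p : state -> state -> R)
    (pi : probability (nat * nat)%type R) : Prop :=
  forall y : state,
    (\esum_(x in [set: state]) (pi [set x] * (p x y)%:E))%E = pi [set y].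

Definition dTV d (T : measurableType d) (mu nu : probability T R) : \bar R :=
  ereal_sup [set `|mu A - nu A|%E | A in measurable].

Definition geometrically_ergodic (p : state -> state -> R) : Prop :=
  exists2 pi : probability (nat * nat)%type R, invariant_measure p pi &
  exists2 beta : R, 1 < beta &
  forall (x : state) d (Omega : measurableType d) (Pr : probability Omega R)
    (X : nat -> {mfun Omega >-> (nat * nat)%type}),
  markov_chain p x Pr X ->
  ((beta ^+ n)%:E * dTV (distribution Pr (X n)) pi)%E @[n --> \oo] --> 0%E.

Definition transient (p : state -> state -> R) : Prop :=
  forall (x : state) d (Omega : measurableType d) (Pr : probability Omega R)
    (X : nat -> {mfun Omega >-> (nat * nat)%type}),
  markov_chain p x Pr X ->
  forall y : state, {ae Pr, forall w, finite_set [set n | X n w = y]}.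

End MarkovChain.

(* Main.v *)
(* Both halves use test functions for the transition operator P.

   Ergodicity follows from a drift condition P V <= g V + K with g < 1 and from
   P^2 (x, (0, 0)) being bounded below on sublevel sets of V, by contraction of a
   weighted oscillation. If a^+ + b^+ < 1, a linear V works. Otherwise a >= 1 and
   b < 0; there V (i, j) is essentially i psi (i / j) for a suitable increasing
   psi.

   Transience follows from a bounded superharmonic function that is strictly
   superharmonic at (0, 0), which bounds the expected number of visits to (0, 0),
   a state reached in two steps from anywhere with positive probability. These
   functions are built from 1 / (k + m), since
   E [1 / (K + m)] <= 1 / (s + m - 1) for K Poisson of parameter s. *)
Require Import Defs.
From HB Require Import structures.
From mathcomp Require Import all_boot all_order all_algebra.
From mathcomp Require Import all_classical all_reals all_analysis.
From mathcomp Require Import ring lra.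

Set Implicit Arguments.
Unset Strict Implicit.
Unset Printing Implicit Defensive.

Import Order.TTheory GRing.Theory Num.Theory.
Import numFieldNormedType.Exports.

Local Open Scope classical_set_scope.
Local Open Scope ring_scope.

(** * Markov operators *)

(** The threshold comes from the ratio of consecutive values. Without noise and immigration it moves
    by [r |-> a + b / r], and for [b < 0] sustained growth needs a ratio [r >= 1] with
    [r <= a + b / r], that is [- b <= a * r - r ^+ 2]. On [r >= 1] the right side has maximum
    [a - 1], at [r = 1], if [a <= 2], and [a ^+ 2 / 4], at [r = a / 2], if [a >= 2]; this is [bc].
    Below it the ratio is eventually driven under 1, but X may grow a lot in the meantime: for
    [a >= 1] no linear V decreases from [(i, 0)], and [psi] has to charge a large ratio for the
    growth still to come. Above it a cone of large ratios is mapped into its interior.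

    The statement concerns every realization of the chain. All that is used of a realization is that
    X_n lies in A with probability P^n 1_A evaluated at the initial state: transience then needs
    Borel-Cantelli but no stopping times, and the invariant probability is built as the limit of P^n
    1_A, with an error uniform in A. *)

Section MarkovOperator.
Context {R : realType} {T : choiceType}.
Implicit Types (p : T -> T -> R) (f g : T -> \bar R) (Q : (T -> \bar R) -> T -> \bar R).
Local Open Scope ereal_scope.

(** Acting on nonnegative extended functions avoids all integrability conditions. The axioms are
    stable under composition, so they serve the kernel, its square and its iterates alike;
    [mop_nneseries] is monotone convergence, from which the limit inherits countable additivity. *)
Record markov_op Q : Prop := MarkovOp {
  mop_ge0 : forall f x, (forall y, 0 <= f y) -> 0 <= Q f x;
  mop_le : forall f g x, (forall y, 0 <= f y) -> (forall y, f y <= g y) ->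
    Q f x <= Q g x;
  mopD : forall f g x, (forall y, 0 <= f y) -> (forall y, 0 <= g y) ->
    Q (fun y => f y + g y) x = Q f x + Q g x;
  mopZ : forall (c : R) f x, (0 <= c)%R -> (forall y, 0 <= f y) ->
    Q (fun y => c%:E * f y) x = c%:E * Q f x;
  mop1 : forall x, Q (fun=> 1) x = 1;
  mop_nneseries : forall (F : nat -> T -> \bar R) x,
    (forall i y, 0 <= F i y) ->
    Q (fun y => \sum_(0 <= i <oo) F i y) x = \sum_(0 <= i <oo) Q (F i) x }.

Definition kop p f x := \esum_(y in [set: T]) ((p x y)%:E * f y).

Definition stochastic p :=
  (forall x y, (0 <= p x y)%R) /\
  (forall x, \esum_(y in [set: T]) (p x y)%:E = 1).

(** For [c] positive, one inequality applied to [c] and to its inverse gives both. *)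
Lemma esumZl (D : set T) (c : R) (f : T -> \bar R) : (0 <= c)%R ->
  (forall y, 0 <= f y) ->
  \esum_(y in D) (c%:E * f y) = c%:E * \esum_(y in D) f y.
Proof.
move=> c0 f0.
have le_half (d : R) (g : T -> \bar R) : (0 <= d)%R -> (forall y, 0 <= g y) ->
    \esum_(y in D) (d%:E * g y) <= d%:E * \esum_(y in D) g y.
  move=> d0 g0; apply: ge_ereal_sup => _ [X [finX XD]] <-.
  rewrite -ge0_mule_fsumr//; apply: lee_wpmul2l; first by rewrite lee_fin.
  by apply: ereal_sup_ubound; exists X.
apply/eqP; rewrite eq_le le_half//=.
have [->|c_neq0] := eqVneq c 0%R.
  by rewrite mul0e esum_ge0// => y _; rewrite mul0e.
have cgt0 : (0 < c)%R by rewrite lt_neqAle eq_sym c_neq0.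
rewrite -lee_pdivlMl//.
have -> : \esum_(i in D) f i = \esum_(i in D) ((c^-1)%:E * (c%:E * f i)).
  by apply: eq_esum => y _; rewrite muleA -EFinM mulVf// mul1e.
by apply: le_half => [|y]; rewrite ?invr_ge0// mule_ge0.
Qed.

Lemma esum_interchange (T' : choiceType) (F : T -> T' -> \bar R) :
  (forall x y, 0 <= F x y) ->
  \esum_(x in [set: T]) \esum_(y in [set: T']) F x y =
  \esum_(y in [set: T']) \esum_(x in [set: T]) F x y.
Proof.
move=> F0; rewrite !esum_esum//.
rewrite [RHS](reindex_esum ([set: T] `*`` (fun=> [set: T'])) _
  (fun z : T * T' => (z.2, z.1)))//.
by split=> [[]|[x y] [x' y'] _ _ [-> ->]|[y x] _]//; exists (x, y).
Qed.

Lemma kop_markov p : stochastic p -> markov_op (kop p).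
Proof.
move=> [p0 p1]; split.
- by move=> f x f0; apply: esum_ge0 => y _; rewrite mule_ge0// lee_fin.
- by move=> f g x f0 fg; apply: le_esum => y _; rewrite lee_wpmul2l// lee_fin.
- move=> f g x f0 g0; rewrite /kop -esumD//; last 2 first.
  + by move=> y _; rewrite mule_ge0// lee_fin.
  + by move=> y _; rewrite mule_ge0// lee_fin.
  by apply: eq_esum => y _; rewrite ge0_muleDr.
- move=> c f x c0 f0; rewrite /kop -esumZl//; last first.
    by move=> y; rewrite mule_ge0// lee_fin.
  by apply: eq_esum => y _; rewrite muleCA.
- by move=> x; rewrite -[RHS](p1 x); apply: eq_esum => y _; rewrite mule1.
- move=> F x F0.
  rewrite nneseries_esumT; last first.
    by move=> i; apply: esum_ge0 => y _; rewrite mule_ge0// lee_fin.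
  rewrite /kop -esum_interchange; last first.
    by move=> y i; rewrite mule_ge0// lee_fin.
  apply: eq_esum => y _; rewrite -nneseriesZl//.
  by rewrite nneseries_esumT// => i; rewrite mule_ge0// lee_fin.
Qed.

Lemma comp_markov Q Q' : markov_op Q -> markov_op Q' ->
  markov_op (fun f => Q (Q' f)).
Proof.
move=> mQ mQ'; split.
- by move=> f x f0; apply: mop_ge0 => // y; exact: mop_ge0.
- move=> f g x f0 fg; apply: mop_le => // y; first exact: mop_ge0.
  exact: mop_le.
- move=> f g x f0 g0; rewrite -mopD//; last 2 first.
  + by move=> y; exact: mop_ge0.
  + by move=> y; exact: mop_ge0.
  by congr (Q _ x); apply/funext => y; rewrite mopD.
- move=> c f x c0 f0; rewrite -mopZ//; last by move=> y; exact: mop_ge0.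
  by congr (Q _ x); apply/funext => y; rewrite mopZ.
- move=> x; rewrite -[RHS](mop1 mQ x).
  by congr (Q _ x); apply/funext => y; rewrite mop1.
- move=> F x F0; rewrite -mop_nneseries//; last by move=> i y; exact: mop_ge0.
  by congr (Q _ x); apply/funext => y; rewrite mop_nneseries.
Qed.

Lemma iter_markov Q n : markov_op Q -> markov_op (fun f => iter n Q f).
Proof.
move=> mQ; elim: n => [|n ih]; last exact: (comp_markov mQ ih).
by split.
Qed.

Definition ind (A : set T) (x : T) : \bar R := (\1_A x)%:E.

Lemma ind_ge0 A x : 0 <= ind A x.
Proof. by rewrite lee_fin. Qed.

Lemma ind_le1 A x : ind A x <= 1.
Proof. by rewrite lee_fin indicE; case: (_ \in _). Qed.

Section Operator.
Variables (Q : (T -> \bar R) -> T -> \bar R) (mQ : markov_op Q).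

Lemma mop_cst (c : R) x : (0 <= c)%R -> Q (fun=> c%:E) x = c%:E.
Proof.
move=> c0; have -> : (fun=> c%:E) = (fun _ : T => c%:E * 1).
  by apply/funext => y; rewrite mule1.
by rewrite mopZ// mop1// mule1.
Qed.

Lemma mop_affine (c d : R) f x : (0 <= c)%R -> (0 <= d)%R ->
  (forall y, 0 <= f y) ->
  Q (fun y => c%:E + d%:E * f y) x = c%:E + d%:E * Q f x.
Proof.
move=> c0 d0 f0; rewrite mopD// ?mop_cst ?mopZ//.
by move=> y; rewrite mule_ge0.
Qed.

Lemma mop_le_cst (c : R) f x : (0 <= c)%R -> (forall y, 0 <= f y) ->
  (forall y, f y <= c%:E) -> Q f x <= c%:E.
Proof. by move=> c0 f0 fc; rewrite -(mop_cst x c0) mop_le. Qed.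

Lemma mop_fin_num f x (c : R) : (forall y, 0 <= f y) -> (Q f x <= c%:E) ->
  Q f x \is a fin_num.
Proof.
move=> f0 fc; rewrite ge0_fin_numE ?mop_ge0//.
by rewrite (le_lt_trans fc) ?ltry.
Qed.

End Operator.
End MarkovOperator.

Lemma mop_sum (R : realType) (T I : choiceType) (Q : (T -> \bar R) -> T -> \bar R)
    (s : seq I) (a : I -> R) (f : I -> T -> \bar R) y :
  markov_op Q -> (forall i, 0 <= a i) -> (forall i z, (0 <= f i z)%E) ->
  (Q (fun z => \sum_(i <- s) ((a i)%:E * f i z)) y =
   \sum_(i <- s) ((a i)%:E * Q (f i) y))%E.
Proof.
move=> mQ a0 f0; elim: s => [|i s ih].
  rewrite big_nil (_ : (fun z => _) = fun=> 0%E); last first.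
    by apply/funext => z; rewrite big_nil.
  exact: (mop_cst mQ y (lexx 0)).
rewrite big_cons -ih -(mopZ mQ)// -(mopD mQ).
- by congr (Q _ y); apply/funext => z; rewrite big_cons.
- by move=> z; apply: mule_ge0; [exact: a0|exact: f0].
- by move=> z; apply: sume_ge0 => j _; apply: mule_ge0; [exact: a0|exact: f0].
Qed.

(** * Geometric ergodicity from a drift condition *)

Section Harris.
Context {R : realType} {T : choiceType}.
Variables (Q : (T -> \bar R) -> T -> \bar R) (mQ : markov_op Q).

(* The oscillation bound, a seminorm of [phi] relative to the weight [W], is the
   distance from [phi] to the constants in the [W]-weighted sup norm. *)
Lemma oscillation_center (phi W : T -> R) (k : R) (o : T) :
  0 <= k -> (forall x, 0 <= phi x <= 1) -> (forall x, 0 <= W x) ->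
  (forall x y, phi x <= phi y + k * (W x + W y)) ->
  exists2 t, 0 <= t & forall x, phi x <= t + k * W x /\ t <= phi x + k * W x.
Proof.
move=> k0 phi01 W0 osc.
pose E := [set phi x - k * W x | x in [set: T]].
have Eub y : ubound E (phi y + k * W y).
  by move=> _ [x _ <-]; have := osc x y; lra.
have E0 : E !=set0 by exists (phi o - k * W o), o.
have Es : has_sup E by split=> //; exists (phi o + k * W o).
have kW x : 0 <= k * W x by rewrite mulr_ge0.
exists (Num.max 0 (sup E)); first by rewrite le_max lexx.
move=> x; split.
  have : phi x - k * W x <= sup E by apply: ub_le_sup; [case: Es|exists x].
  have : sup E <= Num.max 0 (sup E) by rewrite le_max lexx orbT.
  lra.
rewrite ge_max ge_sup//= andbT.
by have /andP[? _] := phi01 x; have := kW x; lra.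
Qed.

Lemma mop_bounded_fin_num (phi : T -> R) x : (forall y, 0 <= phi y <= 1) ->
  Q (EFin \o phi) x \is a fin_num.
Proof.
move=> phi01; apply: (mop_fin_num mQ (c := 1)) => [y|].
  by rewrite lee_fin; have /andP[] := phi01 y.
apply: mop_le_cst => // y; rewrite lee_fin; have /andP[//] := phi01 y.
Qed.

Variables (V : T -> R) (g K e : R) (o : T).
Hypotheses (V0 : forall x, 0 <= V x) (g0 : 0 <= g) (g1 : g < 1) (K0 : 0 < K)
  (e0 : 0 < e) (e1 : e <= 1).
Hypothesis drift : forall x, (Q (EFin \o V) x <= (g * V x + K)%:E)%E.
Hypothesis minor : forall x, V x <= 4 * K / (1 - g) ->
  (e%:E <= Q (ind [set o]) x)%E.

Let W x := 1 + e / (2 * K) * V x.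
Let r := 1 - e * (1 - g) / 4.

(* Hairer and Mattingly's form of Harris' theorem: for a small enough multiple
   of [V] in the weight, the drift contracts the oscillation between points where
   [V] is large, and the common atom at [o] contracts it elsewhere. *)
Lemma harris_contraction (phi : T -> R) (k : R) : 0 <= k ->
  (forall x, 0 <= phi x <= 1) ->
  (forall x y, phi x <= phi y + k * (W x + W y)) ->
  forall x y, fine (Q (EFin \o phi) x) <=
    fine (Q (EFin \o phi) y) + r * k * (W x + W y).
Proof.
move=> k0 phi01 osc x y.
have g01 : 0 < 1 - g by rewrite subr_gt0.
set b := e / (2 * K).
have b0 : 0 <= b by rewrite divr_ge0// ltW// mulr_gt0.
have W1 z : 1 <= W z by rewrite lerDl mulr_ge0.
have W0 z : 0 <= W z by have := W1 z; lra.
have [t t0 tP] := oscillation_center o k0 phi01 W0 osc.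
have phi_ge0 z : (0 <= (phi z)%:E)%E by have /andP[] := phi01 z.
have QW z : (Q (EFin \o W) z <= (1 + b * (g * V z + K))%:E)%E.
  have -> : EFin \o W = (fun y => 1%:E + b%:E * (EFin \o V) y)%E.
    by apply/funext => u /=.
  rewrite (mop_affine mQ)//  ?EFinD ?(EFinM b).
  rewrite leeD2l// lee_wpmul2l ?lee_fin//.
pose w z := fine (Q (EFin \o W) z); pose u z := fine (Q (ind [set o]) z).
pose psi z := fine (Q (EFin \o phi) z).
have wE z : Q (EFin \o W) z = (w z)%:E.
  by rewrite fineK// (mop_fin_num mQ _ (QW z))// => v; rewrite lee_fin.
have psiE z : Q (EFin \o phi) z = (psi z)%:E.
  by rewrite fineK// mop_bounded_fin_num.
have uE z : Q (ind [set o]) z = (u z)%:E.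
  rewrite fineK// mop_bounded_fin_num// => v.
  by rewrite indicE; case: (_ \in _); rewrite lexx ler01.
have u0 z : 0 <= u z by rewrite -lee_fin -uE mop_ge0// => v; exact: ind_ge0.
have wub z : w z <= 1 + b * (g * V z + K) by rewrite -lee_fin -wE.
have [phio too] := tP o.
(* Pointwise [phi <= t + k * W]; the slack of this bound at [o] is kept, and averaging weighs it
   with the mass [u x]. The inequality [lo] is its mirror image. *)
have up : psi x + (t + k * W o - phi o) * u x <= t + k * w x.
  rewrite -lee_fin !EFinD !EFinM -psiE -uE -wE -(mop_affine mQ)//.
  have c0 : 0 <= t + k * W o - phi o by lra.
  rewrite -(mopZ mQ)//; last by move=> ?; exact: ind_ge0.
  rewrite -(mopD mQ)//; last by move=> v; apply: mule_ge0 => //; exact: ind_ge0.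
  apply: (mop_le mQ) => v; first apply: adde_ge0.
  - exact: phi_ge0.
  - by apply: mule_ge0 => //; exact: ind_ge0.
  rewrite /ind -!EFinM -!EFinD lee_fin indicE.
  have [tv _] := tP v.
  case: (boolP (v \in _)) => [|_]; last by rewrite mulr0 addr0.
  by rewrite inE/= => ->; rewrite mulr1; lra.
have lo : t + (phi o + k * W o - t) * u y <= psi y + k * w y.
  rewrite -lee_fin !EFinD !EFinM -psiE -uE -wE.
  have c0 : 0 <= phi o + k * W o - t by lra.
  rewrite -(mop_affine mQ)//; last by move=> ?; exact: ind_ge0.
  rewrite -(mopZ mQ)//.
  rewrite -(mopD mQ)//; last by move=> v; apply: mule_ge0; [by []|exact: W0].
  apply: (mop_le mQ) => v; first apply: adde_ge0.
  - by [].
  - by apply: mule_ge0 => //; exact: ind_ge0.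
  rewrite /ind -!EFinM -!EFinD lee_fin indicE.
  have [_ tv] := tP v.
  case: (boolP (v \in _)) => [|_]; last by rewrite mulr0 addr0.
  by rewrite inE/= => ->; rewrite mulr1; lra.
(* The two slacks at [o] add up to [2 * k * W o >= 2 * k], which is what a common mass [d] at [o]
   gains. *)
have step (d : R) : 0 <= d -> d <= u x -> d <= u y ->
    psi x <= psi y + k * (w x + w y - 2 * d).
  move=> d0 dx dy.
  have h1 : (t + k * W o - phi o) * d <= (t + k * W o - phi o) * u x.
    by rewrite ler_wpM2l//; lra.
  have h2 : (phi o + k * W o - t) * d <= (phi o + k * W o - t) * u y.
    by rewrite ler_wpM2l//; lra.
  have h3 : k * d <= k * W o * d.
    by rewrite -mulrA ler_wpM2l// ler_peMl.
  lra.
suff [d d0 [dx dy dw]] : exists2 d, 0 <= d & [/\ d <= u x, d <= u y &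
    w x + w y - 2 * d <= r * (W x + W y)].
  apply: (le_trans (step _ d0 dx dy)); rewrite lerD2l.
  by rewrite (mulrC r) -mulrA ler_wpM2l.
(* The weight is tuned so that the drift constants at [x] and [y] together cost [2 * b * K = e]:
   half of the gain [2 * e] at the atom, and at most half of the gain [(1 - g) * (b * S)] when [S]
   is large. *)
have bK : b * K = e / 2 by rewrite /b; field; rewrite gt_eqF.
set S := V x + V y.
have wS : w x + w y <= 2 + b * g * S + e.
  by have := wub x; have := wub y; rewrite /S; lra.
have WS : W x + W y = 2 + b * S by rewrite /W -/b /S; ring.
have bS0 : 0 <= b * S by rewrite mulr_ge0// addr_ge0.
rewrite WS.
have [Sle|Sge] := leP S (4 * K / (1 - g)).
  exists e; first exact: ltW.
  split.
  - by rewrite -lee_fin -uE minor// (le_trans _ Sle)// lerDl.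
  - by rewrite -lee_fin -uE minor// (le_trans _ Sle)// lerDr.
  - have h1 : e * (1 - g) / 4 <= e / 4.
      by rewrite ler_pM2r// ler_piMr//; [exact: ltW|by rewrite gerBl].
    have h2 : e * (1 - g) / 4 * (b * S) <= (1 - g) * (b * S).
      have h0 : e * (1 - g) <= 1 - g by rewrite ler_piMl// ltW.
      by rewrite ler_wpM2r//; lra.
    by have := e0; rewrite /r; lra.
exists 0 => //; split=> //.
have bS : 2 * e / (1 - g) <= b * S.
  have -> : 2 * e / (1 - g) = b * (4 * K / (1 - g)).
    by rewrite /b; field; rewrite !gt_eqF.
  by rewrite ler_wpM2l// ltW.
have h1 : 2 * e <= (1 - g) * (b * S).
  by move: bS; rewrite ler_pdivrMr// (mulrC (b * S)).
have h2 : e * (1 - g) / 4 * (b * S) <= (1 - g) * (b * S) / 4.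
  have h0 : e * (1 - g) <= 1 - g by rewrite ler_piMl// ltW.
  by have := ler_wpM2r bS0 h0; lra.
have h3 : e * (1 - g) <= e by rewrite ler_piMr//; [exact: ltW|by rewrite gerBl].
by have := e0; rewrite /r; lra.
Qed.

End Harris.

Section GeometricConvergence.
Context {R : realType} {T : choiceType}.

(** The passages to the limit in the construction of the invariant probability are all brought to
    this form. *)
Lemma le_of_geometric (a b c r : R) : 0 <= r -> r < 1 ->
  (forall n, a <= b + r ^+ n * c) -> a <= b.
Proof.
move=> r0 r1 le_n.
have cvg_b : (b + r ^+ n * c) @[n --> \oo] --> b.
  rewrite -[X in _ --> X]addr0; apply: cvgD; first exact: cvg_cst.
  rewrite -[X in _ --> X](mul0r c); apply: cvgMr_tmp.
  by apply: cvg_expr; rewrite ger0_norm.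
rewrite -(cvg_lim _ cvg_b)//; apply: limr_ge; first by apply/cvg_ex; exists b.
exact: nearW.
Qed.

Variables (P : (T -> \bar R) -> T -> \bar R) (mP : markov_op P).
Variables (V : T -> R) (g K : R) (o : T).
Hypotheses (V0 : forall x, 0 <= V x) (g0 : 0 <= g) (g1 : g < 1) (K0 : 0 < K).
Hypothesis drift : forall x, (P (EFin \o V) x <= (g * V x + K)%:E)%E.

Let phi (A : set T) n x := fine (iter n P (ind A) x).

Lemma iter_indE A n x : iter n P (ind A) x = (phi A n x)%:E.
Proof.
rewrite fineK// (mop_fin_num (iter_markov n mP) (c := 1))//.
  by move=> y; exact: ind_ge0.
apply: (mop_le_cst (iter_markov n mP)) => // y; first exact: ind_ge0.
exact: ind_le1.
Qed.

Lemma iter_ind01 A n x : 0 <= phi A n x <= 1.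
Proof.
rewrite -!lee_fin -iter_indE (mop_ge0 (iter_markov n mP))/=; last first.
  by move=> y; exact: ind_ge0.
apply: (mop_le_cst (iter_markov n mP)) => // y; first exact: ind_ge0.
exact: ind_le1.
Qed.

Lemma iter_drift n x :
  (iter n P (EFin \o V) x <= (V x + K / (1 - g))%:E)%E.
Proof.
have g01 : 0 < 1 - g by rewrite subr_gt0.
have L0 : 0 <= K / (1 - g) by rewrite divr_ge0// ltW.
elim: n x => [|n ih] x; first by rewrite lee_fin lerDl.
have ihV y : (iter n P (EFin \o V) y <= (V y + K / (1 - g))%:E)%E by exact: ih.
rewrite iterSr.
have -> : (V x + K / (1 - g) = K + (g * (K / (1 - g)) + V x))%R.
  by field; rewrite gt_eqF.
have := mop_le (iter_markov n mP) (f := P (EFin \o V))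
  (g := fun y => (K%:E + g%:E * (EFin \o V) y)%E) x.
move=> /(_ _ _)/le_trans -> //.
- by move=> y; apply: (mop_ge0 mP) => z; rewrite lee_fin.
- by move=> y; rewrite -EFinM -EFinD addrC; exact: drift.
rewrite (mop_affine (iter_markov n mP))//; last exact: ltW.
rewrite EFinD leeD2l//.
apply: (@le_trans _ _ (g%:E * (V x + K / (1 - g))%:E)%E).
  by rewrite lee_wpmul2l.
rewrite -EFinM lee_fin mulrDr addrC lerD2l ler_piMl// ltW//.
Qed.

Hypothesis minor : forall M, exists2 e : R, 0 < e &
  forall x, V x <= M -> (e%:E <= P (P (ind [set o])) x)%E.

Theorem geometric_convergence : exists r, 0 < r < 1 /\
  exists C : T -> R, (forall x, 0 <= C x) /\ exists pi : set T -> R,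
  forall A n x, `|phi A n x - pi A| <= r ^+ n * C x.
Proof.
have g01 : 0 < 1 - g by rewrite subr_gt0.
pose Q f := P (P f); have mQ : markov_op Q by exact: comp_markov.
have gg1 : g ^+ 2 < 1 by rewrite expr_lt1.
have gg01 : 0 < 1 - g ^+ 2 by rewrite subr_gt0.
have K20 : 0 < (1 + g) * K by rewrite mulr_gt0// ltr_pwDl.
have Qdrift x : (Q (EFin \o V) x <= (g ^+ 2 * V x + (1 + g) * K)%:E)%E.
  have := mop_le mP (f := P (EFin \o V))
    (g := fun y => (K%:E + g%:E * (EFin \o V) y)%E) x.
  move=> /(_ _ _)/le_trans -> //.
  - by move=> y; apply: (mop_ge0 mP) => z; rewrite lee_fin.
  - by move=> y; rewrite -EFinM -EFinD addrC; exact: drift.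
  rewrite (mop_affine mP)//; last exact: ltW.
  apply: (@le_trans _ _ (K%:E + g%:E * (g * V x + K)%:E)%E).
    by rewrite leeD2l// lee_wpmul2l.
  by rewrite -EFinM -EFinD lee_fin; lra.
have [e e0 eP] := minor (4 * ((1 + g) * K) / (1 - g ^+ 2)).
pose e' := Num.min e 1.
have e'0 : 0 < e' by rewrite lt_min e0 ltr01.
have e'1 : e' <= 1 by rewrite ge_min lexx orbT.
have e'P x : V x <= 4 * ((1 + g) * K) / (1 - g ^+ 2) ->
    (e'%:E <= Q (ind [set o]) x)%E.
  by move=> /eP; apply: le_trans; rewrite lee_fin ge_min lexx.
pose b := e' / (2 * ((1 + g) * K)).
have b0 : 0 <= b by rewrite divr_ge0 ?ltW// mulr_gt0.
pose W x := 1 + b * V x.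
have W1 z : 1 <= W z by rewrite lerDl mulr_ge0.
have W0 z : 0 <= W z by exact: le_trans (W1 z).
pose rho := 1 - e' * (1 - g ^+ 2) / 4.
have ee : 0 < e' * (1 - g ^+ 2) <= 1.
  by rewrite mulr_gt0//= mulr_ile1 ?(ltW e'0) ?(ltW gg01)// gerBl exprn_ge0.
have rho0 : 0 < rho by rewrite /rho; lra.
have rho1 : rho < 1 by rewrite /rho; lra.
have oscQ A m s x y :
    phi A (m.*2 + s) x <= phi A (m.*2 + s) y + rho ^+ m * (W x + W y).
  elim: m x y => [|m ih] x y.
    rewrite expr0 mul1r; have /andP[_] := iter_ind01 A (0.*2 + s) x.
    have /andP[] := iter_ind01 A (0.*2 + s) y.
    by have := W1 x; have := W0 y; lra.
  have := harris_contraction mQ V0 (exprn_ge0 2 g0) gg1 K20 e'0 e'1 Qdrift e'P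
    (exprn_ge0 m (ltW rho0)) (iter_ind01 A (m.*2 + s)) ih x y.
  have -> : EFin \o phi A (m.*2 + s)%N = iter (m.*2 + s) P (ind A).
    by apply/funext => z; rewrite iter_indE.
  by rewrite -exprS.
(* [rho] is the factor for two steps; an odd remaining step costs at most one factor [r^-1], which
   goes into the constant. *)
pose r := Num.sqrt rho.
have r0 : 0 < r by rewrite sqrtr_gt0.
have r1 : r < 1 by rewrite -sqrtr1 ltr_sqrt.
have rr : r ^+ 2 = rho by rewrite sqr_sqrtr// ltW.
have osc A n x y : phi A n x <= phi A n y + r ^+ n * (r^-1 * (W x + W y)).
  have nE : n = (n./2.*2 + odd n)%N by rewrite addnC odd_double_half.
  have := oscQ A n./2 (odd n) x y; rewrite -nE => /le_trans; apply.
  rewrite lerD2l mulrA; apply: ler_wpM2r; first exact: addr_ge0.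
  rewrite ler_pdivlMr// {2}nE exprD -mul2n exprM rr ler_wpM2l//.
    by rewrite exprn_ge0// ltW.
  by case: (odd n); rewrite ?expr1 ?expr0// ltW.
pose Wo := W o + b * (K / (1 - g)).
have Wo0 : 0 <= Wo by rewrite addr_ge0// mulr_ge0// divr_ge0// ltW.
pose C x := r^-1 * (W x + Wo).
have C0 x : 0 <= C x.
  by apply: mulr_ge0; [rewrite invr_ge0 ltW|exact: addr_ge0].
have phiD A n m : EFin (phi A (m + n) o) = iter m P (EFin \o phi A n) o.
  rewrite -iter_indE iterD; congr (iter m P _ o).
  by apply/funext => z; rewrite iter_indE.
have iterW m : (iter m P (EFin \o W) o <= Wo%:E)%E.
  have mPm := iter_markov m mP.
  have -> : EFin \o W = (fun y => 1%:E + b%:E * (EFin \o V) y)%E by [].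
  rewrite (mop_affine mPm)// /Wo /W -addrA -mulrDr EFinD (EFinM b) leeD2l//.
  by rewrite lee_wpmul2l// iter_drift.
have rn0 n : 0 <= r ^+ n * r^-1 by rewrite mulr_ge0 ?invr_ge0 ?exprn_ge0 ?ltW.
(* [phi A (m + n) o] is the mean of [phi A n] under the law after [m] steps from [o], and [W] has
   mean at most [Wo] under that law, whatever [m]. *)
have upper A n m x : phi A (m + n) o <= phi A n x + r ^+ n * C x.
  have mPm := iter_markov m mP.
  pose c := phi A n x + r ^+ n * r^-1 * W x.
  have c0 : 0 <= c.
    by have /andP[? _] := iter_ind01 A n x; rewrite addr_ge0// mulr_ge0.
  rewrite -lee_fin phiD.
  have := mop_le mPm (f := EFin \o phi A n)
    (g := fun y => (c%:E + (r ^+ n * r^-1)%:E * (EFin \o W) y)%E) o.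
  move=> /(_ _ _)/le_trans -> //.
  - by move=> y; rewrite lee_fin; have /andP[] := iter_ind01 A n y.
  - move=> y; rewrite -EFinM -EFinD lee_fin (le_trans (osc A n y x))//.
    by rewrite /c; lra.
  rewrite (mop_affine mPm)//.
  apply: (@le_trans _ _ (c%:E + (r ^+ n * r^-1)%:E * Wo%:E)%E).
    by rewrite leeD2l// lee_wpmul2l// lee_fin.
  by rewrite -EFinM -EFinD lee_fin /c /C; lra.
have lower A n m x : phi A n x <= phi A (m + n) o + r ^+ n * C x.
  have mPm := iter_markov m mP.
  rewrite -lee_fin EFinD phiD.
  have := mop_le mPm (f := fun=> (phi A n x)%:E) (g := fun y =>
    ((EFin \o phi A n) y + ((r ^+ n * r^-1 * W x)%:E
      + (r ^+ n * r^-1)%:E * (EFin \o W) y))%E) o.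
  have phi0 z : 0 <= phi A n z by have /andP[] := iter_ind01 A n z.
  have rnW0 z : 0 <= r ^+ n * r^-1 * W z by rewrite mulr_ge0.
  rewrite (mop_cst mPm)// => /(_ _ _)/le_trans -> //.
  - by move=> y; rewrite lee_fin.
  - move=> y; rewrite -EFinM -!EFinD lee_fin (le_trans (osc A n x y))//.
    by lra.
  rewrite (mopD mPm)//; last first.
    by move=> y; rewrite -EFinM -EFinD lee_fin addr_ge0.
  rewrite leeD2l// (mop_affine mPm)//.
  apply: (@le_trans _ _ ((r ^+ n * r^-1 * W x)%:E + (r ^+ n * r^-1)%:E * Wo%:E)%E).
    by rewrite leeD2l// lee_wpmul2l// lee_fin.
  by rewrite -EFinM -EFinD lee_fin /C; lra.
exists r; split; first by rewrite r0.
exists (fun x => C x + C o); split; first by move=> x; rewrite addr_ge0.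
(* Around each [phi A n o] lies an interval of radius [r ^+ n * C o]. By [upper] and [lower] every
   left end is below every right end, so the infimum of the right ends belongs to all the
   intervals. *)
pose E A := [set phi A n o + r ^+ n * C o | n in [set: nat]].
have Elb A n : lbound (E A) (phi A n o - r ^+ n * C o).
  move=> _ [m _ <-].
  have [nm|mn] := leP n m.
    have := lower A n (m - n)%N o; rewrite subnK// => h.
    have : 0 <= r ^+ m * C o by rewrite mulr_ge0// exprn_ge0// ltW.
    by lra.
  have := upper A m (n - m)%N o; rewrite subnK 1?ltnW// => h.
  have : 0 <= r ^+ n * C o by rewrite mulr_ge0// exprn_ge0// ltW.
  by lra.
exists (fun A => inf (E A)) => A n x.
have E0 : E A !=set0 by exists (phi A 0 o + r ^+ 0 * C o), 0%N.
have Ei : has_inf (E A) by split=> //; exists (phi A 0 o - r ^+ 0 * C o).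
have h1 : inf (E A) <= phi A n o + r ^+ n * C o.
  by apply: ge_inf; [case: Ei|exists n].
have h2 : phi A n o - r ^+ n * C o <= inf (E A) by apply: lb_le_inf.
have := lower A n 0 x; have := upper A n 0 x; rewrite add0n => h3 h4.
by rewrite ler_norml; apply/andP; split; lra.
Qed.

End GeometricConvergence.

(** * The law of the chain as an iterate of the operator *)

Section Law.
Context {R : realType}.
Local Open Scope ereal_scope.

Lemma measurable_state (A : set (nat * nat)) : measurable A.
Proof.
apply: countable_measurable; last exact: countableP.
move=> -[i j].
rewrite (_ : [set (i, j)] = [set i] `*` [set j]); first exact: measurableX.
by apply/seteqP; split=> [[x y] [-> ->]|[x y] [/= -> ->]].
Qed.

(** The fibers of [Y] are numbered by [pickle], since sigma-additivity concerns sequences; codes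
    outside its range give empty pieces. *)
Lemma measure_fibers d (Omega : measurableType d)
    (mu : probability Omega R) (Y : Omega -> nat * nat)
    (B : set Omega) : (forall A, measurable (Y @^-1` A)) -> measurable B ->
  mu B = \esum_(v in [set: nat * nat]) mu (B `&` Y @^-1` [set v]).
Proof.
move=> mY mB.
pose F k := B `&` [set w | pickle (Y w) = k].
have mF k : measurable (F k).
  apply: measurableI => //.
  exact: (mY [set v | pickle v = k]).
have -> : B = \bigcup_k F k.
  apply/seteqP; split=> [w Bw|w [k _ []]//].
  by exists (pickle (Y w)).
rewrite measure_semi_bigcup//; last 2 first.
- move=> i j _ _ [w [[_ /= <-] [_ /= <-]]]//.
- exact: bigcup_measurable.
rewrite nneseries_esumT//.
pose rg := range (@pickle (nat * nat)%type).
transitivity (\esum_(k in rg) mu (F k)).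
  rewrite [RHS]esum_mkcond; apply: eq_esum => k _.
  case: (boolP (k \in rg)) => // krg.
  rewrite (_ : F k = set0) ?measure0//; apply/seteqP; split=> // w [_ /= kE].
  by move: krg; rewrite -kE notin_setE => /(_ (imageT _ _)).
rewrite (reindex_esum [set: nat * nat] rg pickle).
  apply: eq_esum => v _; congr (mu _); apply/seteqP; split=> w.
    move=> [Bw /= /(pcan_inj pickleK) vE]; split=> //.
    by exists (pickle (Y w)).
  by move=> [[k _ [Bw kE]] /= vE]; split=> //=; rewrite vE.
split=> [k /= _|v w _ _|k [v _ <-]]; first exact: imageT.
  by move=> /(pcan_inj (@pickleK _)).
by exists v.
Qed.

Section Chain.
Variables (p : state -> state -> R) (x : state) (d : measure_display)
  (Omega : measurableType d) (Pr : probability Omega R)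
  (X : nat -> {mfun Omega >-> (nat * nat)%type}).
Hypotheses (sp : stochastic p) (mc : markov_chain p x Pr X).

Lemma measurable_state_preimage n (A : set (nat * nat)) :
  measurable (X n @^-1` A).
Proof.
by rewrite -[X in measurable X]setTI; apply: measurable_funP; [|exact: measurable_state].
Qed.

Let window (m n : nat) (s : nat -> state) : set Omega :=
  [set w | forall k, (m <= k <= n)%N -> X k w = s k].

Let measurable_window m n s : measurable (window m n s).
Proof.
have -> : window m n s =
    \bigcap_k [set w | (m <= k <= n)%N -> X k w = s k].
  apply/seteqP; split=> w h k; [move=> _; exact: h|exact: (h k)].
apply: bigcapT_measurable => k.
have [mkn|mkn] := boolP (m <= k <= n)%N.
  rewrite (_ : [set w | _] = X k @^-1` [set s k]).
    exact: measurable_state_preimage.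
  by apply/seteqP; split=> w //= h; exact: h.
rewrite (_ : [set w | _] = setT); first exact: measurableT.
by apply/seteqP; split=> // w.
Qed.

(** The definition of the chain conditions on the whole past from time 0. Summing over the state at
    time [m] removes that time from the conditioning, and induction removes any initial stretch. *)
Let window_Markov m n s : (m <= n)%N ->
  Pr (window m n.+1 s) = Pr (window m n s) * (p (s n) (s n.+1))%:E.
Proof.
elim: m s => [|m ih] s mn.
  have E N : window 0 N s = path_event X s N.
    by apply/seteqP; split=> w h k kN; apply: h => //; case/andP: kN.
  by rewrite !E; have [_] := mc; exact.
have split_at N : (m < N)%N -> forall v,
    window m.+1 N s `&` X m @^-1` [set v] =
    window m N (fun k => if k == m then v else s k).
  move=> mN v; apply/seteqP; split=> w.
    move=> [h /= hv] k /andP[mk kN]; case: eqP => [->//|/eqP km].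
    by apply: h; rewrite kN andbT ltn_neqAle eq_sym km mk.
  move=> h; split=> [k /andP[mk kN]|/=].
    have := h k; rewrite kN (ltnW mk) => /(_ isT) ->.
    by rewrite gtn_eqF.
  by have := h m; rewrite leqnn (ltnW mN) eqxx => /(_ isT).
have mX := measurable_state_preimage.
rewrite (measure_fibers Pr (mX m) (measurable_window m.+1 n.+1 s)).
rewrite (measure_fibers Pr (mX m) (measurable_window m.+1 n s)).
rewrite muleC -esumZl//; last by have [p0 _] := sp; exact: p0.
apply: eq_esum => v _; rewrite (split_at _ mn) (split_at _ (leqW mn)).
by rewrite (ih _ (ltnW mn)) (gtn_eqF mn) (gtn_eqF (leqW mn)) muleC.
Qed.

Definition law n (f : state -> \bar R) :=
  \esum_(y in [set: state]) (Pr (X n @^-1` [set y]) * f y).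

Lemma law0 f : (forall y, 0 <= f y) -> law 0 f = f x.
Proof.
move=> f0; have [Pr1 _] := mc.
rewrite -(mul1e (f x)) -Pr1 /law.
rewrite -(esum_set1 (a := fun y => Pr (X 0%N @^-1` [set y]) * f y)); last first.
  by rewrite mule_ge0.
rewrite [RHS]esum_mkcond; apply: eq_esum => y _.
case: (boolP (y \in [set x])) => //; rewrite notin_setE/= => /eqP yx.
rewrite (_ : Pr _ = 0) ?mul0e//; apply/eqP; rewrite eq_le measure_ge0 andbT.
have mX := measurable_state_preimage.
have -> : 0 = Pr (~` (X 0%N @^-1` [set x])).
  by rewrite probability_setC// Pr1 subee.
apply: le_measure; rewrite ?inE//; first exact: measurableC.
by move=> w /= -> /eqP; apply/negP.
Qed.

(** The window from [n] to [n.+1] gives the joint law of [X n] and [X n.+1]; summing over the later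
    state first yields [kop p f]. *)
Lemma lawS n f : (forall y, 0 <= f y) -> (forall y, f y \is a fin_num) ->
  law n.+1 f = law n (kop p f).
Proof.
move=> f0 f_fin; have [p0 _] := sp.
have step y z : Pr (X n.+1 @^-1` [set z] `&` X n @^-1` [set y]) =
    Pr (X n @^-1` [set y]) * (p y z)%:E.
  pose s k := if k == n then y else z.
  transitivity (Pr (window n n.+1 s)).
    congr (Pr _); apply/seteqP; split=> w.
      move=> [/= hz hy] k /andP[nk]; rewrite leq_eqVlt ltnS => /orP[/eqP->|kn].
        by rewrite /s gtn_eqF.
      by have /eqP <- : n == k; [rewrite eqn_leq nk kn|rewrite /s eqxx].
    move=> h; split=> /=; first by rewrite h ?leqnSn ?leqnn// /s gtn_eqF.
    by rewrite h ?leqnSn ?leqnn// /s eqxx.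
  rewrite window_Markov// /s eqxx gtn_eqF//.
  congr (Pr _ * _); apply/seteqP; split=> w /=.
    by move=> h; rewrite h ?leqnn ?eqxx.
  by move=> h k; rewrite -eqn_leq => /eqP <-; rewrite eqxx.
have pe0 y z : 0 <= (p y z)%:E by rewrite lee_fin.
rewrite /law /kop.
transitivity (\esum_(z in [set: state]) \esum_(y in [set: state])
    (Pr (X n @^-1` [set y]) * ((p y z)%:E * f z))).
  apply: eq_esum => z _.
  have mX := measurable_state_preimage.
  rewrite (measure_fibers Pr (mX n) (measurable_state_preimage _ _)).
  rewrite muleC.
  rewrite -(fineK (f_fin z)) -esumZl//; last by rewrite fine_ge0.
  by apply: eq_esum => y _; rewrite step muleC muleA.
rewrite esum_interchange; last first.
  by move=> z y; rewrite !mule_ge0.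
apply: eq_esum => y _.
rewrite -(fineK (fin_num_measure Pr _ (measurable_state_preimage n [set y]))).
rewrite esumZl// ?fine_ge0// => z; by rewrite mule_ge0.
Qed.

End Chain.
End Law.

Section LawIterates.
Context {R : realType}.
Local Open Scope ereal_scope.
Variables (p : state -> state -> R) (x : state) (d : measure_display)
  (Omega : measurableType d) (Pr : probability Omega R)
  (X : nat -> {mfun Omega >-> (nat * nat)%type}).
Hypotheses (sp : stochastic p) (mc : markov_chain p x Pr X).

Lemma law_iter n f : (forall y, 0 <= f y <= 1) ->
  law Pr X n f = iter n (kop p) f x.
Proof.
have mP := kop_markov sp.
elim: n f => [|n ih] f f01.
  by rewrite (law0 mc)// => y; have /andP[] := f01 y.
have f0 y : 0 <= f y by have /andP[] := f01 y.
have Pf01 y : 0 <= kop p f y <= 1.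
  rewrite (mop_ge0 mP)//= (mop_le_cst mP (c := 1))// => z.
  by have /andP[] := f01 z.
rewrite (lawS sp mc)//; last first.
  move=> y; rewrite ge0_fin_numE// (le_lt_trans _ (ltry 1%R))//.
  by case/andP: (f01 y).
by rewrite ih// iterSr.
Qed.

Lemma ind01 (A : set state) y : 0 <= ind (R := R) A y <= 1.
Proof. by rewrite ind_ge0 ind_le1. Qed.

Lemma law_ind n A : law Pr X n (ind A) = Pr (X n @^-1` A).
Proof.
rewrite (measure_fibers Pr (measurable_state_preimage X n)
  (measurable_state_preimage X n A)).
apply: eq_esum => y _; rewrite /ind indicE.
case: (boolP (y \in A)); rewrite ?inE ?notin_setE => Ay.
  rewrite mule1; congr (Pr _); apply/seteqP.
  by split=> [w /= ->//|w []//].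
rewrite mule0 (_ : _ `&` _ = set0) ?measure0//.
by apply/seteqP; split=> // w [/= Aw wy]; apply: Ay; rewrite -wy.
Qed.

(** Both halves of the theorem use the realization [X] only through this identity for its one-time
    marginals. *)
Lemma probability_iter n A : Pr (X n @^-1` A) = iter n (kop p) (ind A) x.
Proof. by rewrite -law_ind law_iter//; exact: ind01. Qed.

End LawIterates.

(** * The invariant probability as the limit of the n-step probabilities *)

Section SetProbability.
Context {R : realType} (pi : set (nat * nat) -> \bar R).
Hypotheses (pi0 : pi set0 = 0%E) (pi_ge0 : forall A, (0 <= pi A)%E)
  (pi_sigma : semi_sigma_additive pi) (piT : pi setT = 1%E).

(** Carrying the proofs as arguments gives a term to which the instances of measure and probability
    can be attached. *)
Definition set_probability of pi set0 = 0%E & (forall A, (0 <= pi A)%E) &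
  semi_sigma_additive pi & pi setT = 1%E := pi.

Local Notation mu := (set_probability pi0 pi_ge0 pi_sigma piT).

HB.instance Definition _ := isMeasure.Build _ _ _ mu pi0 pi_ge0 pi_sigma.
HB.instance Definition _ := Measure_isProbability.Build _ _ _ mu piT.

Lemma exists_probability :
  exists m : probability (nat * nat)%type R, forall A, m A = pi A.
Proof. by exists mu. Qed.

End SetProbability.

Lemma sum_additive (R : realType) (m : set state -> R) (F : nat -> set state) N :
  m set0 = 0 -> (forall A B, A `&` B = set0 -> m (A `|` B) = m A + m B) ->
  trivIset setT F ->
  \sum_(0 <= i < N) m (F i) = m (\bigcup_(i in `I_N) F i).
Proof.
move=> m0 mU tF; elim: N => [|N ih].
  by rewrite big_nil II0 bigcup_set0 m0.
rewrite big_nat_recr//= ih IIS bigcup_setU bigcup_set1 mU//.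
rewrite setI_bigcupl; apply: bigcup0 => i /= iN.
apply/seteqP; split=> // w [Fi FN].
by have := tF i N I I (ex_intro _ w (conj Fi FN)) => iE; rewrite iE ltnn in iN.
Qed.

Section InvariantProbability.
Context {R : realType}.
Variables (p : state -> state -> R) (o : state) (r : R) (C : state -> R)
  (lim : set state -> R).
Hypotheses (sp : stochastic p) (r0 : 0 <= r) (r1 : r < 1).
Let mP := kop_markov sp.
Let Phi n (A : set state) := fine (iter n (kop p) (ind A) o).
Hypothesis cvg_lim : forall A n, `|Phi n A - lim A| <= r ^+ n * C o.

Let PhiE n A : iter n (kop p) (ind A) o = (Phi n A)%:E.
Proof. exact: (iter_indE mP). Qed.

Let Phi_ub n A : Phi n A <= lim A + r ^+ n * C o.
Proof. by have := cvg_lim A n; rewrite ler_norml => /andP[? ?]; lra. Qed.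

Let Phi_lb n A : lim A <= Phi n A + r ^+ n * C o.
Proof. by have := cvg_lim A n; rewrite ler_norml => /andP[? ?]; lra. Qed.

Let Phi0 n A : 0 <= Phi n A.
Proof. by have /andP[] := iter_ind01 mP A n o. Qed.

Lemma limit_eq A (a : nat -> R) (k c : R) :
  (forall n, `|a n - k| <= r ^+ n * c) -> (forall n, Phi n A = a n) ->
  lim A = k.
Proof.
move=> ak aE; apply/eqP; rewrite eq_le; apply/andP; split.
  apply: (@le_of_geometric _ _ _ (c + C o) r) => // n.
  have := ak n; have := cvg_lim A n; rewrite aE !ler_norml.
  by move=> /andP[? ?] /andP[? ?]; lra.
apply: (@le_of_geometric _ _ _ (c + C o) r) => // n.
have := ak n; have := cvg_lim A n; rewrite aE !ler_norml.
by move=> /andP[? ?] /andP[? ?]; lra.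
Qed.

Lemma limit_setT : lim setT = 1.
Proof.
apply: (limit_eq (a := fun=> 1) (c := 0)) => [n|n].
  by rewrite subrr normr0 mulr0.
apply: EFin_inj; rewrite -PhiE -[RHS](mop1 (iter_markov n mP) o).
by congr (iter n _ _ o); apply/funext => y; rewrite /ind indicE in_setT.
Qed.

Let PhiU n A B : A `&` B = set0 -> Phi n (A `|` B) = Phi n A + Phi n B.
Proof.
move=> AB.
apply: EFin_inj; rewrite EFinD -!PhiE -(mopD (iter_markov n mP)); last 2 first.
- by move=> ?; exact: ind_ge0.
- by move=> ?; exact: ind_ge0.
congr (iter n _ _ o); apply/funext => y.
rewrite /ind -EFinD !indicE in_setU.
case: (boolP (y \in A)); case: (boolP (y \in B)); rewrite ?addr0 ?add0r//.
rewrite !inE => By Ay; have : set0 y by rewrite -AB.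
by [].
Qed.

Lemma limitU A B : A `&` B = set0 -> lim (A `|` B) = lim A + lim B.
Proof.
move=> AB; apply: (limit_eq (a := fun n => Phi n A + Phi n B)
  (c := C o + C o)) => n.
  rewrite opprD addrACA (le_trans (ler_normD _ _))// mulrDr.
  by rewrite lerD.
exact: PhiU.
Qed.

Lemma limit_set0 : lim set0 = 0.
Proof. by have := limitU (set0I set0); rewrite setU0; lra. Qed.

Lemma limit_ge0 A : 0 <= lim A.
Proof.
apply: (@le_of_geometric _ _ _ (C o) r) => // n.
exact: le_trans (Phi0 n A) (Phi_ub n A).
Qed.

(** The error [r ^+ n * C o] is the same for all sets, so one fixed [n] can be used for the union
    and for all its finite subunions at once; countable additivity at time [n] then passes to the
    limit. *)
Lemma limit_sigma_additive : semi_sigma_additive (fun A => (lim A)%:E).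
Proof.
move=> F mF tF _.
have nneg n : (0 <= (lim (F n))%:E)%E by rewrite lee_fin limit_ge0.
have -> : (lim (\bigcup_n F n))%:E = (\sum_(0 <= i <oo) (lim (F i))%:E)%E;
  last first.
  by apply: is_cvg_nneseries.
have part_le N : \sum_(0 <= i < N) lim (F i) <= lim (\bigcup_n F n).
  rewrite (sum_additive _ limit_set0 limitU)// [X in _ <= lim X](_ : _ =
    (\bigcup_(i in `I_N) F i) `|` (\bigcup_n F n `\` \bigcup_(i in `I_N) F i)).
    by rewrite limitU ?setDIK// lerDl limit_ge0.
  by rewrite setDUK//; apply: bigcup_sub => i _; exact: bigcup_sup.
have sum_le : (\sum_(0 <= i <oo) (lim (F i))%:E <= (lim (\bigcup_n F n))%:E)%E.
  apply: lime_le; first exact: is_cvg_nneseries.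
  by apply: nearW => N; rewrite sumEFin lee_fin.
apply/eqP; rewrite eq_le sum_le andbT.
set S := (\sum_(0 <= i <oo) (lim (F i))%:E)%E in sum_le *.
have S_fin : S \is a fin_num.
  by rewrite ge0_fin_numE ?nneseries_ge0// (le_lt_trans sum_le)// ltry.
rewrite -(fineK S_fin) lee_fin.
apply: (@le_of_geometric _ _ _ (C o + C o) r) => // n.
apply: (le_trans (Phi_lb n _)); rewrite mulrDr addrA lerD2r.
rewrite -lee_fin EFinD -PhiE (fineK S_fin).
have -> : ind (R := R) (\bigcup_n F n) =
    (fun y => \sum_(0 <= i <oo) ind (F i) y)%E.
  apply/funext => y; rewrite /ind indicE.
  case: (boolP (y \in _)); rewrite ?inE ?notin_setE => yF.
    have [i _ Fi] := yF; rewrite (nneseriesD1 (n := i))//.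
    rewrite indicE mem_set//= eseries0 ?adde0// => j _ /= ji.
    rewrite indicE memNset// => Fj.
    by have := tF j i I I (ex_intro _ y (conj Fj Fi)) => /eqP; apply/negP.
  rewrite eseries0// => i _ _; rewrite indicE memNset// => Fi.
  by apply: yF; exists i.
rewrite (mop_nneseries (iter_markov n mP))//; last by move=> *; exact: ind_ge0.
apply: lime_le.
  apply: is_cvg_nneseries => i _ _; apply: (mop_ge0 (iter_markov n mP)) => y.
  exact: ind_ge0.
apply: nearW => N.
have -> : (\sum_(0 <= i < N) iter n (kop p) (ind (F i)) o =
    (\sum_(0 <= i < N) Phi n (F i))%:E)%E.
  by rewrite -sumEFin; apply: eq_bigr => i _; rewrite PhiE.
have PhiS : \sum_(0 <= i < N) Phi n (F i) = Phi n (\bigcup_(i in `I_N) F i).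
  apply: sum_additive => //; last exact: PhiU.
  by have := PhiU n (set0I set0); rewrite setU0; lra.
rewrite PhiS (@le_trans _ _ (lim (\bigcup_(i in `I_N) F i) + r ^+ n * C o)%:E)//.
  by rewrite lee_fin.
rewrite EFinD leeD2r// -(sum_additive _ limit_set0 limitU)// -sumEFin.
exact: nneseries_lim_ge.
Qed.

(* Only this inequality is a Fatou argument; equality then follows because both
   sides are probabilities. *)
Lemma limit_subinvariant A :
  (\esum_(x in [set: state]) ((lim [set x])%:E * kop p (ind A) x) <=
   (lim A)%:E)%E.
Proof.
pose a x := fine (kop p (ind A) x).
have aE x : kop p (ind A) x = (a x)%:E by exact: (iter_indE mP A 1 x).
have a01 x : 0 <= a x <= 1 by exact: (iter_ind01 mP A 1 x).
have C0 : 0 <= C o.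
  by have := cvg_lim A 0; rewrite expr0 mul1r; apply: le_trans.
apply: ge_ereal_sup => _ [X [finX _] <-].
rewrite fsbig_finite//=; set s : seq state := finmap.enum_fset _.
have s_uniq : uniq s by exact: finmap.fset_uniq.
under eq_bigr do rewrite aE -EFinM.
rewrite sumEFin lee_fin.
apply: (@le_of_geometric _ _ _ (\sum_(x <- s) C o + C o) r) => // n.
have le1 : \sum_(x <- s) lim [set x] * a x <=
    \sum_(x <- s) Phi n [set x] * a x + r ^+ n * \sum_(x <- s) C o.
  rewrite mulr_sumr -big_split/=; apply: ler_sum => x _.
  have /andP[ax0 ax1] := a01 x.
  apply: (@le_trans _ _ ((Phi n [set x] + r ^+ n * C o) * a x)).
    by rewrite ler_wpM2r.
  by rewrite mulrDl lerD2l ler_piMr// mulr_ge0// exprn_ge0.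
have mPn := iter_markov n mP.
(* The sum is the [n]-th iterate applied to [kop p (ind A)] cut off outside [s]; without the cut-off
   it would be iterate [n.+1] of [ind A]. *)
have le2 : \sum_(x <- s) Phi n [set x] * a x <= Phi n.+1 A.
  rewrite -lee_fin -sumEFin.
  have -> : (\sum_(x <- s) (Phi n [set x] * a x)%:E =
      iter n (kop p) (fun z => \sum_(x <- s) ((a x)%:E * ind [set x] z)) o)%E.
    rewrite (mop_sum _ _ mPn); last 2 first.
    - by move=> x; have /andP[] := a01 x.
    - by move=> *; exact: ind_ge0.
    by apply: eq_bigr => x _; rewrite PhiE -EFinM mulrC.
  rewrite -PhiE iterSr; apply: (mop_le mPn) => z.
    apply: sume_ge0 => x _; apply: mule_ge0; last exact: ind_ge0.
    by rewrite lee_fin; have /andP[] := a01 x.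
  have off x : x != z -> ((a x)%:E * ind [set x] z = 0)%E.
    move=> xz; rewrite /ind indicE memNset ?mule0// => /= zx.
    by rewrite zx eqxx in xz.
  rewrite aE; have [zs|zs] := boolP (z \in s).
    rewrite (bigD1_seq z)//= big1 ?adde0//.
    by rewrite /ind indicE mem_set// mule1.
  rewrite big_seq big1 => [|x xs]; first by rewrite lee_fin; have /andP[] := a01 z.
  by apply: off; apply: contraNneq zs => <-.
have := Phi_ub n.+1 A.
have : r ^+ n.+1 * C o <= r ^+ n * C o.
  by rewrite ler_wpM2r// exprS ler_piMl ?exprn_ge0// ltW.
by lra.
Qed.

Lemma invariant_limit (pi : probability (nat * nat)%type R) :
  (forall A, pi A = (lim A)%:E) -> invariant_measure p pi.
Proof.
move=> piE y; have [p0 _] := sp.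
pose nu A := (\esum_(x in [set: state]) ((lim [set x])%:E * kop p (ind A) x))%E.
have nu_le A : (nu A <= (lim A)%:E)%E by exact: limit_subinvariant.
have nu0 A : (0 <= nu A)%E.
  apply: esum_ge0 => x _; apply: mule_ge0; first by rewrite lee_fin limit_ge0.
  by apply: (mop_ge0 mP) => z; exact: ind_ge0.
have nu_fin A : nu A \is a fin_num.
  by rewrite ge0_fin_numE// (le_lt_trans (nu_le A))// ltry.
have nuC A : (nu A + nu (~` A) = 1)%E.
  rewrite /nu -esumD; last 2 first.
  - move=> x _; apply: mule_ge0; first by rewrite lee_fin limit_ge0.
    by apply: (mop_ge0 mP) => z; exact: ind_ge0.
  - move=> x _; apply: mule_ge0; first by rewrite lee_fin limit_ge0.
    by apply: (mop_ge0 mP) => z; exact: ind_ge0.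
  transitivity (\esum_(x in [set: state]) pi [set x]).
    apply: eq_esum => x _; rewrite piE -ge0_muleDr; last 2 first.
    - by apply: (mop_ge0 mP) => z; exact: ind_ge0.
    - by apply: (mop_ge0 mP) => z; exact: ind_ge0.
    rewrite -(mopD mP); last 2 first.
    - by move=> ?; exact: ind_ge0.
    - by move=> ?; exact: ind_ge0.
    rewrite (_ : (fun z => _) = fun=> 1%E) ?(mop1 mP) ?mule1//.
    apply/funext => z; rewrite /ind -EFinD !indicE in_setC.
    by case: (_ \in _); rewrite ?addr0 ?add0r.
  have := measure_fibers pi (Y := idfun)
    (fun A => measurable_state A) measurableT.
  rewrite probability_setT => ->; apply: eq_esum => x _; rewrite setTI.
  by congr (pi _).
have nu_eq A : nu A = (lim A)%:E.
  apply/eqP; rewrite eq_le nu_le/=.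
  have := nuC A; have := nu_le (~` A).
  rewrite -(fineK (nu_fin A)) -(fineK (nu_fin (~` A))) -EFinD => le1 eq1.
  have := EFin_inj eq1; move: le1; rewrite !lee_fin => le1 eq2.
  have : lim setT = lim A + lim (~` A) by rewrite -limitU ?setICr// setUCr.
  by rewrite limit_setT; lra.
rewrite piE -nu_eq /nu; apply: eq_esum => x _; rewrite piE; congr (_ * _)%E.
rewrite /kop -(esum_set1 (a := fun z => (p x z)%:E)) ?lee_fin//.
rewrite esum_mkcond; apply: eq_esum => z _; rewrite /ind indicE.
by case: (_ \in _); rewrite ?mule1 ?mule0.
Qed.

End InvariantProbability.

Theorem geometrically_ergodic_of_drift (R : realType) (p : state -> state -> R)
    (V : state -> R) (g K : R) (o : state) :
  stochastic p -> (forall x, 0 <= V x) -> 0 <= g -> g < 1 -> 0 < K ->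
  (forall x, (kop p (EFin \o V) x <= (g * V x + K)%:E)%E) ->
  (forall M, exists2 e : R, 0 < e &
    forall x, V x <= M -> (e%:E <= kop p (kop p (ind [set o])) x)%E) ->
  geometrically_ergodic p.
Proof.
move=> sp V0 g0 g1 K0 drift minor.
have mP := kop_markov sp.
have [r [/andP[r0 r1] [C [C0 [lim cvg_lim]]]]] :=
  geometric_convergence mP V0 g0 g1 K0 drift minor.
have r0' := ltW r0; have cvg_o A n := cvg_lim A n o.
have [pi piE] := exists_probability
  (congr1 EFin (limit_set0 sp r0' r1 cvg_o))
  (fun A => limit_ge0 sp r0' r1 cvg_o A : (0 <= (lim A)%:E)%E)
  (limit_sigma_additive sp r0' r1 cvg_o)
  (congr1 EFin (limit_setT sp r0' r1 cvg_o)).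
exists pi; first exact: (invariant_limit sp r0' r1 cvg_o piE).
(* Any number strictly between 1 and [r^-1] would do; the midpoint gives
   [beta * r = (1 + r) / 2 < 1]. *)
pose beta := (1 + r^-1) / 2.
have rV1 : 1 < r^-1 by rewrite invf_gt1.
have beta_r : beta * r = (1 + r) / 2 by rewrite /beta; field; rewrite gt_eqF.
exists beta; first by rewrite /beta; lra.
move=> x d Omega Pr X mc.
have dTV_le n : (dTV (distribution Pr (X n)) pi <= (r ^+ n * C x)%:E)%E.
  apply: ge_ereal_sup => _ [A mA <-].
  suff : (`|Pr (X n @^-1` A) - pi A| <= (r ^+ n * C x)%:E)%E by [].
  by rewrite (probability_iter sp mc) piE (iter_indE mP) -EFinB lee_fin.
have dTV_ge0 n : (0 <= dTV (distribution Pr (X n)) pi)%E.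
  apply: (@le_trans _ _ `|distribution Pr (X n) set0 - pi set0|%E) => //.
  by apply: ereal_sup_ubound; exists set0.
apply: (@squeeze_cvge _ _ _ _ (fun=> 0%E) _
  (fun n => (((1 + r) / 2) ^+ n * C x)%:E)).
- apply: nearW => n; have b0 : 0 <= beta ^+ n by rewrite exprn_ge0// /beta; lra.
  rewrite mule_ge0//=.
  rewrite (le_trans (lee_wpmul2l _ (dTV_le n)))//.
  by rewrite -EFinM lee_fin mulrA -exprMn beta_r.
- exact: cvg_cst.
- apply: cvg_EFin; first exact: nearW.
  rewrite -[X in _ --> X](mul0r (C x)); apply: cvgMr_tmp.
  by apply: cvg_expr; rewrite ger0_norm; lra.
Qed.

(** * Transience from a superharmonic function *)

Lemma infinite_visits_lim_sup (T : Type) (F : nat -> set T) w :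
  ~ finite_set [set n | F n w] -> lim_sup_set F w.
Proof.
move=> infF N _; apply: contrapT => noF; apply: infF.
apply: (sub_finite_set _ (finite_II N)) => n /= Fn.
rewrite ltnNge; apply/negP => Nn; apply: noF.
by exists n.
Qed.

(** The mean of [h] along the chain stays in [0, 1] and loses at least [eta] times the probability
    of being at [o] at each step, so these probabilities have sum at most [eta^-1]. A visit to [y]
    is followed two steps later by one to [o] with probability at least [c], hence those of [y] are
    summable too, and Borel-Cantelli applies. *)
Theorem transient_of_superharmonic (R : realType) (p : state -> state -> R)
    (h : state -> R) (o : state) :
  stochastic p -> (forall x, 0 <= h x <= 1) ->
  (forall x, (kop p (EFin \o h) x <= (h x)%:E)%E) ->
  (kop p (EFin \o h) o < (h o)%:E)%E ->
  (forall y, (0 < kop p (kop p (ind [set o])) y)%E) ->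
  transient p.
Proof.
move=> sp h01 hP hPo acc x d Omega Pr X mc y.
have mP := kop_markov sp.
have h0 z : 0 <= h z by have /andP[] := h01 z.
have [u uE] : exists u : nat -> R,
    forall n, iter n (kop p) (EFin \o h) x = (u n)%:E.
  exists (fun n => fine (iter n (kop p) (EFin \o h) x)) => n.
  by rewrite fineK// (mop_bounded_fin_num (iter_markov n mP)).
pose q A n := fine (iter n (kop p) (ind A) x).
have qE A n : iter n (kop p) (ind A) x = (q A n)%:E by exact: (iter_indE mP).
have q01 A n : 0 <= q A n <= 1 by exact: (iter_ind01 mP).
have Ph_fin := mop_bounded_fin_num mP o h01.
pose eta := h o - fine (kop p (EFin \o h) o).
have eta0 : 0 < eta by rewrite subr_gt0 -lte_fin fineK.
have u_dec n : u n.+1 + eta * q [set o] n <= u n.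
  have mPn := iter_markov n mP.
  rewrite -lee_fin EFinD EFinM -!uE -qE iterSr -(mopZ mPn) ?(ltW eta0)//;
    last by move=> ?; exact: ind_ge0.
  rewrite -(mopD mPn); last 2 first.
  - by move=> z; apply: (mop_ge0 mP) => v; rewrite lee_fin.
  - by move=> z; apply: mule_ge0; [rewrite lee_fin ltW|exact: ind_ge0].
  apply: (mop_le mPn) => z.
    apply: adde_ge0; first by apply: (mop_ge0 mP) => v; rewrite lee_fin.
    by apply: mule_ge0; [rewrite lee_fin ltW|exact: ind_ge0].
  rewrite /ind indicE; have [|_] := boolP (z \in _); last by rewrite mule0 adde0.
  rewrite inE => /= ->; rewrite mule1 -(fineK Ph_fin) -EFinD lee_fin /eta.
  by lra.
have sum_q N : eta * \sum_(0 <= n < N) q [set o] n <= 1.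
  have telescope : eta * \sum_(0 <= n < N) q [set o] n <= u 0 - u N.
    elim: N => [|N ih]; first by rewrite big_nil subrr mulr0.
    by rewrite big_nat_recr//= mulrDr; have := u_dec N; lra.
  have uN : 0 <= u N.
    rewrite -lee_fin -uE (mop_ge0 (iter_markov N mP))// => v.
  have u0 : u 0 <= 1.
    by rewrite -lee_fin -uE lee_fin; have /andP[] := h01 x.
  by lra.
have [c c0 cP] : exists2 c : R, 0 < c &
    (c%:E <= kop p (kop p (ind [set o])) y)%E.
  exists (fine (kop p (kop p (ind [set o])) y)).
    have := acc y; rewrite (iter_indE mP [set o] 2 y : kop p (kop p _) y = _).
    by rewrite lte_fin.
  by rewrite (iter_indE mP [set o] 2 y : kop p (kop p _) y = _).
have q_le n : c * q [set y] n <= q [set o] n.+2.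
  have mPn := iter_markov n mP.
  rewrite -lee_fin EFinM -!qE -(mopZ mPn) ?(ltW c0)//; last first.
    by move=> ?; exact: ind_ge0.
  rewrite !iterSr; apply: (mop_le mPn) => z.
    by apply: mule_ge0; [rewrite lee_fin ltW|exact: ind_ge0].
  rewrite /ind indicE; have [|_] := boolP (z \in _).
    by rewrite inE => /= ->; rewrite mule1.
  rewrite mule0; apply: (mop_ge0 mP) => v; apply: (mop_ge0 mP) => w.
  exact: ind_ge0.
have sum_fin : (\sum_(0 <= n <oo) Pr (X n @^-1` [set y]) < +oo)%E.
  apply: (@le_lt_trans _ _ ((c * eta)^-1)%:E); last exact: ltry.
  apply: lime_le; first exact: is_cvg_nneseries.
  apply: nearW => N.
  under eq_bigr do rewrite (probability_iter sp mc) qE.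
  rewrite sumEFin lee_fin -[leRHS]mul1r ler_pdivlMr ?mulr_gt0//.
  have le1 : c * \sum_(0 <= n < N) q [set y] n <=
      \sum_(0 <= n < N.+2) q [set o] n.
    rewrite mulr_sumr.
    rewrite big_nat_recl//= big_nat_recl//=.
    have /andP[? _] := q01 [set o] 0%N; have /andP[? _] := q01 [set o] 1%N.
    apply: (@le_trans _ _ (\sum_(0 <= i < N) q [set o] i.+2)); last by lra.
    by apply: ler_sum => n _; exact: q_le.
  have := sum_q N.+2; have := ler_wpM2l (ltW eta0) le1; lra.
have mX n : measurable (X n @^-1` [set y]).
  exact: measurable_state_preimage.
exists (lim_sup_set (fun n => X n @^-1` [set y])); split.
- apply: bigcap_measurable; first by exists 0%N.
  by move=> k _; apply: bigcup_measurable => j _.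
- exact: lim_sup_set_cvg0.
- by move=> w /= inf_w; exact: infinite_visits_lim_sup.
Qed.

(** * Poisson transitions *)

Definition origin : state := (0%N, 0%N).

Section Poisson.
Context {R : realType}.
Implicit Types (s : R) (g : nat -> R).

Definition pois s k : R := expR (- s) * s ^+ k / k`!%:R.

Definition Epois s g : \bar R := \sum_(0 <= k <oo) (pois s k * g k)%:E.

Lemma pois_ge0 s k : 0 <= s -> 0 <= pois s k.
Proof. by move=> s0; rewrite divr_ge0// mulr_ge0// ?exprn_ge0// expR_ge0. Qed.

Lemma Epois_ge0 s g : 0 <= s -> (forall k, 0 <= g k) -> (0 <= Epois s g)%E.
Proof.
move=> s0 g0; apply: nneseries_ge0 => k _ _.
by rewrite lee_fin mulr_ge0// pois_ge0.
Qed.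

Lemma le_Epois s g g' : 0 <= s -> (forall k, 0 <= g k) ->
  (forall k, g k <= g' k) -> (Epois s g <= Epois s g')%E.
Proof.
move=> s0 g0 gg'; apply: lee_nneseries => [k _ _|k _].
  by rewrite lee_fin mulr_ge0// pois_ge0.
by rewrite lee_fin ler_wpM2l// pois_ge0.
Qed.

Lemma EpoisD s g g' : 0 <= s -> (forall k, 0 <= g k) -> (forall k, 0 <= g' k) ->
  Epois s (fun k => g k + g' k) = (Epois s g + Epois s g')%E.
Proof.
move=> s0 g0 g'0; rewrite /Epois -nneseriesD; last 2 first.
- by move=> k _ _; rewrite lee_fin mulr_ge0// pois_ge0.
- by move=> k _ _; rewrite lee_fin mulr_ge0// pois_ge0.
by apply: eq_eseriesr => k _; rewrite mulrDr EFinD.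
Qed.

Lemma EpoisZ s c g : 0 <= s -> (forall k, 0 <= g k) ->
  Epois s (fun k => c * g k) = (c%:E * Epois s g)%E.
Proof.
move=> s0 g0; rewrite /Epois -nneseriesZl; last first.
  by move=> k _; rewrite lee_fin mulr_ge0// pois_ge0.
by apply: eq_eseriesr => k _; rewrite mulrCA EFinM.
Qed.

Lemma Epois1 s : 0 <= s -> Epois s (fun=> 1) = 1%E.
Proof.
move=> s0.
have -> : Epois s (fun=> 1) = ((expR (- s))%:E *
    \sum_(0 <= k <oo) (exp_coeff s k)%:E)%E.
  rewrite -nneseriesZl; last by move=> k _; rewrite lee_fin exp_coeff_ge0.
  by apply: eq_eseriesr => k _; rewrite mulr1 -EFinM mulrA.
have -> : (\sum_(0 <= k <oo) (exp_coeff s k)%:E = (expR s)%:E)%E.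
  apply/cvg_lim => //; under eq_fun do rewrite sumEFin.
  by apply: cvg_EFin; [exact: nearW|exact: is_cvg_series_exp_coeff].
by rewrite -EFinM mulrC expRxMexpNx_1.
Qed.

Lemma Epois_cst s c : 0 <= s -> Epois s (fun=> c) = c%:E.
Proof.
move=> s0; rewrite -[RHS]mule1 -(Epois1 s0) -EpoisZ//.
by under [in RHS]eq_fun do rewrite mulr1.
Qed.

(* Stein's identity E[K g(K - 1)] = s E[g(K)]; the truncated predecessor at
   [k = 0] is harmless, as the factor [k] vanishes there. *)
Lemma Epois_stein s g : 0 <= s -> (forall k, 0 <= g k) ->
  Epois s (fun k => k%:R * g k.-1) = (s%:E * Epois s g)%E.
Proof.
move=> s0 g0; rewrite -EpoisZ// /Epois nneseries_recl//; last first.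
  by move=> k _; rewrite lee_fin mulr_ge0 ?pois_ge0// mulr_ge0.
rewrite mul0r mulr0 add0e -(nneseries_addn 1); last first.
  by move=> k; rewrite lee_fin mulr_ge0 ?pois_ge0// mulr_ge0.
apply: eq_eseriesr => k _; congr EFin.
rewrite addn1/= /pois factS natrM exprS; field.
by rewrite nat1r !pnatr_eq0 -lt0n fact_gt0.
Qed.

Lemma Epois_id s : 0 <= s -> Epois s (fun k => k%:R) = s%:E.
Proof.
move=> s0; rewrite -[RHS]mule1 -(Epois1 s0) -Epois_stein//.
by under [in RHS]eq_fun do rewrite mulr1.
Qed.

(** Stein's identity with [k + 1] gives the second moment. The square is then expanded as [(k - s)
    ^+ 2 + 2 * s * k = k ^+ 2 + s ^+ 2], which keeps all terms nonnegative. *)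
Lemma Epois_variance s : 0 <= s -> Epois s (fun k => (k%:R - s) ^+ 2) = s%:E.
Proof.
move=> s0.
have E2 : Epois s (fun k => k%:R ^+ 2) = (s ^+ 2 + s)%:E.
  have -> : (s ^+ 2 + s)%:E = (s%:E * Epois s (fun k => (k%:R + 1)%R))%E.
    by rewrite EpoisD// Epois_id// Epois1// -EFinD -EFinM mulrDr mulr1 expr2.
  rewrite -Epois_stein//.
  congr Epois; apply/funext => -[|k]; first by rewrite mul0r expr0n.
  by rewrite -natr1/= natr1 expr2.
have : (Epois s (fun k => ((k%:R - s) ^+ 2)%R) + (2 * s * s)%:E =
    (s ^+ 2 + s + s ^+ 2)%:E)%E.
  have -> : (2 * s * s)%:E = Epois s (fun k => 2 * s * k%:R).
    by rewrite EpoisZ// Epois_id.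
  rewrite -EpoisD//; last 2 first.
  - by move=> k; exact: sqr_ge0.
  - by move=> k; rewrite !mulr_ge0.
  rewrite EFinD -E2 -(Epois_cst (s ^+ 2) s0) -EpoisD//; last first.
    by move=> _; exact: sqr_ge0.
  by congr Epois; apply/funext => k; ring.
case: (Epois _ _) => [v| |]//; rewrite -EFinD => vE.
by congr EFin; have := EFin_inj vE; lra.
Qed.

Lemma Epois_le_quadratic s g A B D : 0 <= s -> 0 <= A -> 0 <= B -> 0 <= D ->
  (forall k, 0 <= g k <= A + B * k%:R + D * (k%:R - s) ^+ 2) ->
  (Epois s g <= (A + B * s + D * s)%:E)%E.
Proof.
move=> s0 A0 B0 D0 gP.
have B0' k : 0 <= B * k%:R by rewrite mulr_ge0.
have D0' k : 0 <= D * (k%:R - s) ^+ 2 by rewrite mulr_ge0// sqr_ge0.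
apply: le_trans (le_Epois (g' := fun k => A + B * k%:R + D * (k%:R - s) ^+ 2) s0 _ _) _.
- by move=> k; have /andP[] := gP k.
- by move=> k; have /andP[] := gP k.
rewrite EpoisD//; last by move=> k; rewrite addr_ge0.
rewrite EpoisD// !EpoisZ//; last by move=> k; exact: sqr_ge0.
by rewrite Epois_id// Epois_variance// Epois_cst// -!EFinM -!EFinD.
Qed.

(** By Stein's identity [s * E [1 / (K + m)] = E [K / (K - 1 + m)]]. For [K >= 1], lowering the
    denominator of [(m - 1) / (K + m)] by 1 as well makes the two fractions add up to 1; at [K = 0]
    only [(m - 1) / m] remains. *)
Lemma Epois_inv s m : 0 <= s -> 1 <= m ->
  ((s + (m - 1))%:E * Epois s (fun k => (k%:R + m)^-1%R) <= 1)%E.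
Proof.
move=> s0 m1.
have inv0 k : 0 <= (k%:R + m)^-1 :> R by rewrite invr_ge0 addr_ge0//; lra.
rewrite EFinD ge0_muleDl ?lee_fin//; last lra.
rewrite -Epois_stein// -EpoisZ// -EpoisD//; last 2 first.
- by move=> k; rewrite mulr_ge0.
- by move=> k; rewrite mulr_ge0//; lra.
rewrite -[leRHS](Epois1 s0); apply: le_Epois => // [k|[|k]].
- by rewrite addr_ge0 ?mulr_ge0//; lra.
- by rewrite mul0r !add0r ler_pdivrMr; lra.
have k0 : 0 <= k%:R :> R by [].
rewrite -natr1/=.
have le1 : (m - 1) * (k%:R + 1 + m)^-1 <= (m - 1) * (k%:R + m)^-1.
  by rewrite ler_wpM2l//; [lra|rewrite lef_pV2 ?posrE; lra].
apply: (@le_trans _ _ ((k%:R + 1) * (k%:R + m)^-1 + (m - 1) * (k%:R + m)^-1)).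
  by rewrite lerD2l.
by rewrite -mulrDl ler_pdivrMr; lra.
Qed.

End Poisson.

Section PoissonKernel.
Context {R : realType}.
Variables (a b lambda : R).
Local Notation p := (transition a b lambda).

Lemma rate_ge0 x : 0 <= rate a b lambda x.
Proof. by rewrite /rate le_max lexx. Qed.

Lemma transition_ge0 x y : 0 <= p x y.
Proof. by rewrite mulr_ge0// pois_ge0// rate_ge0. Qed.

Lemma kop_transition (f : state -> R) x : (forall y, 0 <= f y) ->
  kop p (EFin \o f) x = Epois (rate a b lambda x) (fun k => f (k, x.1)).
Proof.
move=> f0; rewrite /Epois nneseries_esumT; last first.
  by move=> k; rewrite lee_fin mulr_ge0// pois_ge0// rate_ge0.
pose D := [set y : state | y.2 = x.1].
transitivity (\esum_(y in D) (p x y * f y)%:E).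
  rewrite [RHS]esum_mkcond; apply: eq_esum => -[k l] _.
  have [//|] := boolP ((k, l) \in D); rewrite notin_setE /D/= => /eqP lx.
  by move: lx => /= /negbTE lx; rewrite /transition/= eq_sym lx mul0r mul0e.
rewrite (reindex_esum [set: nat] D (fun k => (k, x.1))).
  by apply: eq_esum => k _; rewrite /transition/= eqxx mul1r.
by split=> [k _//|k l _ _ [->]//|[k l] lx]; exists k => //; rewrite -lx.
Qed.

Lemma transition_stochastic : stochastic p.
Proof.
split; first exact: transition_ge0.
move=> x; have := kop_transition (f := fun=> 1) x (fun=> ler01).
rewrite Epois1 ?rate_ge0// => <-; apply: eq_esum => y _.
by rewrite /= mule1.
Qed.

Lemma kop_transition_ge (f : state -> R) x k : (forall y, 0 <= f y) ->
  ((pois (rate a b lambda x) k * f (k, x.1))%:E <= kop p (EFin \o f) x)%E.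
Proof.
move=> f0; rewrite kop_transition//.
have ge0 j : (0 <= (pois (rate a b lambda x) j * f (j, x.1))%:E)%E.
  by rewrite lee_fin mulr_ge0// pois_ge0// rate_ge0.
by rewrite /Epois (nneseriesD1 (n := k))// leeDl// nneseries_ge0.
Qed.

(** Two successive draws equal to 0 lead from [x] through [(0, x.1)] to the origin, and a draw at
    rate [s] is 0 with probability [expR (- s)]. *)
Lemma origin_minorization x :
  ((expR (- (rate a b lambda x + rate a b lambda (0%N, x.1))))%:E <=
   kop p (kop p (ind [set origin])) x)%E.
Proof.
have sp := transition_stochastic; have mP := kop_markov sp.
pose f := fun y : state => fine (kop p (ind [set origin]) y).
have fE : kop p (ind [set origin]) = EFin \o f.
  by apply/funext => y; exact: (iter_indE mP [set origin] 1 y).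
have f0 y : 0 <= f y by have /andP[] := iter_ind01 mP [set origin] 1 y.
rewrite fE; apply: le_trans (kop_transition_ge x 0 f0).
rewrite /pois expr0 fact0 mulr1 divr1 opprD expRD lee_fin ler_wpM2l ?expR_ge0//.
rewrite -lee_fin -[in leRHS]/((EFin \o f) (0%N, x.1)) -fE.
have := kop_transition_ge (f := \1_[set origin]) (0%N, x.1) 0.
move=> /(_ _)/(le_trans _) -> //.
by rewrite /pois expr0 fact0 mulr1 divr1 indicE mem_set// mulr1.
Qed.

End PoissonKernel.

(** * The ergodic region *)

Section Ergodic.
Context {R : realType}.
Variables (a b lambda : R) (hlambda : 0 < lambda).
Local Notation p := (transition a b lambda).
Local Notation rate := (rate a b lambda).

Lemma rate_le x : rate x <= (`|a| + `|b|) * (x.1%:R + x.2%:R) + lambda.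
Proof.
have l0 := hlambda.
have /= h1 : a * x.1%:R <= `|a| * x.1%:R by rewrite ler_wpM2r// ler_norm.
have /= h2 : b * x.2%:R <= `|b| * x.2%:R by rewrite ler_wpM2r// ler_norm.
have h3 : 0 <= `|a| * x.1%:R by rewrite mulr_ge0.
have h4 : 0 <= `|b| * x.2%:R by rewrite mulr_ge0.
have h5 : 0 <= `|a| * x.2%:R by rewrite mulr_ge0.
have h6 : 0 <= `|b| * x.1%:R by rewrite mulr_ge0.
by rewrite /Defs.rate ge_max; apply/andP; split; lra.
Qed.

(** The linear lower bound on [V] bounds the coordinates on sublevel sets, hence both rates met on
    the way to the origin. *)
Lemma ergodic_of_drift (V : state -> R) (c g K : R) :
  0 < c -> 0 <= g -> g < 1 -> 0 < K ->
  (forall x, c * (x.1%:R + x.2%:R) <= V x) ->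
  (forall x, (Epois (rate x) (fun k => V (k, x.1)) <= (g * V x + K)%:E)%E) ->
  geometrically_ergodic p.
Proof.
move=> c0 g0 g1 K0 Vc drift.
have V0 x : 0 <= V x.
  by apply: le_trans (Vc x); rewrite mulr_ge0 ?(ltW c0)// addr_ge0.
apply: (@geometrically_ergodic_of_drift _ _ V g K origin) => //.
- exact: transition_stochastic.
- by move=> x; rewrite kop_transition.
move=> M; set L := (`|a| + `|b|) * (M / c) + lambda.
exists (expR (- (L + L))); first exact: expR_gt0.
move=> x VM; apply: le_trans (origin_minorization a b lambda x).
have ab0 : 0 <= `|a| + `|b| by rewrite addr_ge0.
have xM : x.1%:R + x.2%:R <= M / c.
  by rewrite ler_pdivlMr// mulrC (le_trans (Vc x)).
rewrite lee_fin ler_expR lerN2 lerD//.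
  by rewrite (le_trans (rate_le x))// lerD2r ler_wpM2l.
rewrite (le_trans (rate_le _))// lerD2r ler_wpM2l//=.
by rewrite (le_trans _ xM)// add0r lerDl.
Qed.

Lemma ergodic_small : Num.max 0 a + Num.max 0 b < 1 -> geometrically_ergodic p.
Proof.
set A := Num.max 0 a; set B := Num.max 0 b => AB.
have l0 := hlambda.
have A0 : 0 <= A by rewrite le_max lexx.
have B0 : 0 <= B by rewrite le_max lexx.
have aA : a <= A by rewrite le_max lexx orbT.
have bB : b <= B by rewrite le_max lexx orbT.
have d0 : 0 < 1 - A + B by lra.
(* One step takes the mean of [V] to at most [(c^-1 + A) * (c * i) + c * B * j + c * lambda].
   Contraction requires [B < c^-1 < 1 - A], and [c^-1] is taken to be the midpoint. *)
pose c := 2 / (1 - A + B).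
have c0 : 0 < c by rewrite divr_gt0.
have cd : c * (1 - A + B) = 2 by rewrite /c divfK// gt_eqF.
pose g := Num.max (c^-1 + A) (c * B).
have cV : c^-1 = (1 - A + B) / 2 by rewrite /c invfM invrK mulrC.
apply: (@ergodic_of_drift (fun x => x.2%:R + c * x.1%:R)
  (Num.min 1 c) g (c * lambda)).
- by rewrite lt_min ltr01.
- by rewrite /g le_max addr_ge0 ?invr_ge0 ?(ltW c0).
- rewrite /g gt_max; apply/andP; split; first by rewrite cV; lra.
  by rewrite /c mulrAC ltr_pdivrMr//; lra.
- by rewrite mulr_gt0.
- move=> [i j] /=; rewrite mulrDr addrC lerD//.
    by rewrite ler_piMl// ge_min lexx.
  by rewrite ler_wpM2r// ge_min lexx orbT.
move=> [i j] /=; set s := rate _.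
have s0 : 0 <= s by exact: rate_ge0.
have i0 : 0 <= i%:R :> R by []. have j0 : 0 <= j%:R :> R by [].
have sle : s <= A * i%:R + B * j%:R + lambda.
  have h1 : a * i%:R <= A * i%:R by rewrite ler_wpM2r.
  have h2 : b * j%:R <= B * j%:R by rewrite ler_wpM2r.
  have h3 : 0 <= A * i%:R by rewrite mulr_ge0.
  have h4 : 0 <= B * j%:R by rewrite mulr_ge0.
  by rewrite /s /Defs.rate/= ge_max; apply/andP; split; lra.
apply: (le_trans (Epois_le_quadratic (A := i%:R) (B := c) (D := 0) s0 _ _ _ _)) => //.
- exact: ltW.
- by move=> k; rewrite mul0r addr0 lexx andbT addr_ge0// mulr_ge0 ?(ltW c0).
rewrite lee_fin mul0r addr0.
have h1 : (c^-1 + A) * (c * i%:R) <= g * (c * i%:R).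
  apply: ler_wpM2r; first by rewrite mulr_ge0 ?(ltW c0).
  by rewrite /g le_max lexx.
have h2 : c * B * j%:R <= g * j%:R by rewrite ler_wpM2r// /g le_max lexx orbT.
have h3 : c * s <= c * (A * i%:R + B * j%:R + lambda) by rewrite ler_pM2l.
have h4 : c^-1 * (c * i%:R) = i%:R by rewrite mulrA mulVf ?mul1r ?gt_eqF.
lra.
Qed.

(* Without noise and immigration the ratio r = X_n / X_(n-1) evolves by
   r |-> a - B / r, which [gap] makes smaller than r - delta as long as
   r >= theta. The factor [psi r] therefore decreases at each such step by
   expR (q * delta) = expR (a / theta), which beats the growth factor of X, at
   most a; and below theta < 1 the chain itself contracts. Ratios are computed
   with X_(n-1) + 1 in the denominator, which avoids division by 0 at the cost of
   a bounded error. *)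
Section Inhibition.
Variables (theta delta : R).
Let B := - b.
Hypotheses (a1 : 1 <= a) (B0 : 0 < B) (theta0 : 0 < theta) (theta1 : theta < 1)
  (delta0 : 0 < delta)
  (gap : forall r, theta <= r -> (a + delta) * r <= r ^+ 2 + B).

Let M := a + delta.
Let q := a / (theta * delta).
(** A noiseless step leads to a ratio at most [a = M - delta], so the cap [M] does not spoil the
    gain [delta]; it makes [psi] bounded and [x * psi x] Lipschitz. *)
Let clip r := Num.max 0 (Num.min r M - theta).
Let psi r := expR (q * clip r).

Let q0 : 0 < q.
Proof. by rewrite divr_gt0 ?mulr_gt0//; have := a1; lra. Qed.

Let M0 : 0 < M. Proof. by have := a1; have := delta0; rewrite /M; lra. Qed.

Let clip_ge0 r : 0 <= clip r. Proof. by rewrite le_max lexx. Qed.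

Let clip_leM r : clip r <= M.
Proof.
rewrite ge_max ltW//= lerBlDr (@le_trans _ _ M)// ?ge_min ?lexx ?orbT//.
by rewrite lerDl ltW.
Qed.

Let le_clip r r' : r <= r' -> clip r <= clip r'.
Proof.
move=> rr'; rewrite ge_max clip_ge0/= le_max lerD2r le_min !ge_min rr' lexx.
by rewrite !orbT.
Qed.

Let clip_lip r r' : r <= r' -> clip r' - clip r <= r' - r.
Proof.
move=> rr'; rewrite lerBlDl ge_max addr_ge0 ?subr_ge0//=.
have h1 : Num.min r M - theta <= clip r by rewrite le_max lexx orbT.
have h2 : Num.min r' M - (r' - r) <= Num.min r M.
  have : Num.min r' M <= r' by rewrite ge_min lexx.
  have : Num.min r' M <= M by rewrite ge_min lexx orbT.
  by rewrite le_min; move=> h3 h4; apply/andP; split; lra.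
lra.
Qed.

Let psi_ge1 r : 1 <= psi r.
Proof. by rewrite /psi -expR0 ler_expR mulr_ge0// ltW. Qed.

Let le_psi r r' : r <= r' -> psi r <= psi r'.
Proof. by move=> ?; rewrite ler_expR ler_wpM2l ?(ltW q0)// le_clip. Qed.

(** Here [y] is the ratio that follows [r]. If [y <= theta] then [psi y = 1]. The case
    [r < theta < y] cannot occur, because [gap] at [theta] forces [a * r - B < theta * r] there. For
    [r >= theta] and [y > theta] the clipped ratio drops by at least [delta]. *)
Let psi_contract r y : 0 <= r -> 0 <= y -> y * r <= a * r - B ->
  y * psi y <= theta * psi r.
Proof.
move=> r0 y0 yr.
have small : y <= theta -> y * psi y <= theta * psi r.
  move=> yt; have -> : psi y = 1.
    rewrite /psi /clip (_ : Num.max _ _ = 0) ?mulr0 ?expR0//.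
    apply/max_idPl; have : Num.min y M <= y by rewrite ge_min lexx.
    by lra.
  by rewrite mulr1 (le_trans yt)// ler_peMr ?psi_ge1// ltW.
have [|y_gt] := leP y theta; first exact: small.
have [r_lt|r_ge] := ltP r theta.
  have := gap (lexx theta); rewrite expr2 => gt.
  have h1 : theta * r <= y * r by rewrite ler_wpM2r// ltW.
  have h2 : (a - theta) * r <= (a - theta) * theta.
    by rewrite ler_wpM2l// ?ltW//; have := a1; have := theta1; lra.
  have h3 : 0 < delta * theta by rewrite mulr_gt0.
  lra.
have r_gt0 : 0 < r by exact: lt_le_trans r_ge.
have y_le : y <= r - delta.
  rewrite -(ler_pM2r r_gt0) (le_trans yr)//.
  by have := gap r_ge; rewrite expr2; lra.
have y_a : y <= a.
  by rewrite -(ler_pM2r r_gt0) (le_trans yr)//; have := B0; lra.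
have clipy : clip y + delta <= clip r.
  have -> : clip y = y - theta.
    rewrite /clip (min_idPl _) ?(max_idPr _)//; first by lra.
    by rewrite (le_trans y_a)// /M lerDl ltW.
  have : y + delta <= Num.min r M by rewrite le_min /M lerD2r y_a andbT; lra.
  have : Num.min r M - theta <= clip r by rewrite le_max lexx orbT.
  by lra.
have qd : q * delta = a / theta.
  by rewrite /q; field; rewrite !gt_eqF.
have e1 : a / theta * psi y <= psi r.
  apply: (@le_trans _ _ (expR (q * delta) * psi y)).
    by rewrite ler_wpM2r ?expR_ge0// qd (le_trans _ (expR_ge1Dx _))// lerDr.
  rewrite -expRD ler_expR -mulrDr ler_wpM2l ?(ltW q0)//; lra.
have : y * psi y <= a * psi y by rewrite ler_wpM2r// expR_ge0.
have : theta * (a / theta * psi y) <= theta * psi r by rewrite ler_wpM2l// ltW.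
by rewrite mulrA mulrCA divff ?gt_eqF// mulr1; lra.
Qed.

(** A bound for the derivative [psi x + x * psi' x]: both [psi] and [psi' / q] are at most
    [expR (q * M)], and [psi'] vanishes beyond [M]. *)
Let L := expR (q * M) * (1 + q * M).

Let L0 : 0 < L.
Proof. by rewrite mulr_gt0 ?expR_gt0// ltr_pwDl// mulr_ge0 ?ltW. Qed.

Let psi_leM r : psi r <= expR (q * M).
Proof. by rewrite ler_expR ler_wpM2l ?(ltW q0)// clip_leM. Qed.

Let mul_psi_lip x y : 0 <= x -> 0 <= y ->
  x * psi x <= y * psi y + L * `|x - y|.
Proof.
move=> x0 y0.
have [xy|yx] := leP x y.
  have : x * psi x <= y * psi y by rewrite ler_pM ?le_psi// expR_ge0.
  by have : 0 <= L * `|x - y| by [rewrite mulr_ge0// ltW]; lra.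
rewrite ger0_norm ?subr_ge0 ?(ltW yx)//.
have h1 : (x - y) * psi x <= (x - y) * expR (q * M).
  by rewrite ler_wpM2l// subr_ge0 ltW.
have d0 : 0 <= q * (x - y) * expR (q * M).
  by rewrite mulr_ge0 ?expR_ge0// mulr_ge0 ?(ltW q0)// subr_ge0 ltW.
have h2 : y * (psi x - psi y) <= M * (q * (x - y) * expR (q * M)).
  have [My|yM] := leP M y.
    have -> : psi x = psi y.
      rewrite /psi /clip !(min_idPr _)//; exact: le_trans My (ltW yx).
    by rewrite subrr mulr0 mulr_ge0 ?(ltW M0).
  have lip : psi x - psi y <= q * (x - y) * expR (q * M).
    have -> : psi y = psi x * expR (q * (clip y - clip x)).
      by rewrite -expRD; congr expR; ring.
    have h3 : psi x * (1 + q * (clip y - clip x)) <=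
        psi x * expR (q * (clip y - clip x)).
      by rewrite ler_wpM2l ?expR_ge0// expR_ge1Dx.
    have h4 : q * (clip x - clip y) * psi x <= q * (x - y) * expR (q * M).
      rewrite ler_pM ?expR_ge0//.
        by rewrite mulr_ge0 ?(ltW q0)// subr_ge0 le_clip// ltW.
      by rewrite ler_wpM2l ?(ltW q0)// clip_lip// ltW.
    lra.
  by apply: (le_trans (ler_wpM2l y0 lip)); rewrite ler_wpM2r ?(ltW yM).
rewrite /L; lra.
Qed.

Lemma ergodic_inhibition : geometrically_ergodic p.
Proof.
have l0 := hlambda; have B_gt0 := B0; have t0 := theta0; have t1 := theta1.
have a_gt0 : 0 < a by have := a1; lra.
have [k [k0 lip]] : exists k, 0 < k /\ forall x y, 0 <= x -> 0 <= y ->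
    x * psi x <= y * psi y + k * `|x - y|.
  by exists L; split; [exact: L0|exact: mul_psi_lip].
(* The final factor is [theta + 2 * eps = (1 + theta) / 2]: one [eps] pays for the noise, the other
   for the summand [eps * x.2] of the test function, which becomes [eps * i]. The choice of [eta]
   makes the noise term [k * eta * a * i] equal to [eps * i]. *)
pose eps := (1 - theta) / 4; pose eta := eps / (k * a).
have eps0 : 0 < eps by rewrite /eps; lra.
have eta0 : 0 < eta by rewrite divr_gt0// mulr_gt0.
have etaE : k * eta * a = eps by rewrite /eta; field; rewrite !gt_eqF.
have epsE : eps = (1 - theta) / 4 by [].
clearbody eta; clearbody eps.
pose G x := x.1%:R * psi (x.1%:R / (x.2%:R + 1)).
pose K := k * (lambda + B) + k * eta * (lambda + 1) + k / (4 * eta).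
have K0 : 0 < K.
  have k1 : 0 < k * (lambda + B) by rewrite mulr_gt0// addr_gt0.
  have k2 : 0 < k * eta * (lambda + 1) by rewrite mulr_gt0 ?mulr_gt0 ?addr_gt0.
  have k3 : 0 < k / (4 * eta) by rewrite divr_gt0// mulr_gt0.
  by rewrite /K; lra.
apply: (@ergodic_of_drift (fun x => G x + eps * x.2%:R) eps ((1 + theta) / 2) K
  eps0) => //; [lra|lra| |].
  move=> [i j] /=; rewrite /G/= mulrDr lerD2r.
  have : eps * i%:R <= 1 * i%:R by rewrite ler_wpM2r// epsE; lra.
  have : i%:R * 1 <= i%:R * psi (i%:R / (j%:R + 1)) by rewrite ler_wpM2l ?psi_ge1.
  by lra.
move=> [i j]; rewrite [(i, j).1]/=; set s := rate _.
have s0 : 0 <= s by exact: rate_ge0.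
have i0 : 0 <= i%:R :> R by []. have j0 : 0 <= j%:R :> R by [].
have s1 : 0 < s + 1 by lra.
have iG : i%:R <= G (i, j).
  have : i%:R * 1 <= i%:R * psi (i%:R / (j%:R + 1)) by rewrite ler_wpM2l ?psi_ge1.
  by rewrite mulr1.
(* The rate without immigration and with [j + 1] for [j]: when positive, [s' / i] is exactly the
   noiseless successor [a - B / r] of [r = i / (j + 1)]. *)
pose s' := Num.max 0 (a * i%:R - B * (j%:R + 1)).
have s'0 : 0 <= s' by rewrite le_max lexx.
have sE : s = Num.max 0 (a * i%:R - B * (j%:R + 1) + (lambda + B)).
  by rewrite /s /Defs.rate/= /B; congr Num.max; ring.
have s_le : s <= a * i%:R + lambda.
  rewrite sE ge_max; apply/andP; split; first by rewrite addr_ge0 ?mulr_ge0// ltW.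
  have : 0 <= B * j%:R by rewrite mulr_ge0// ltW.
  by lra.
have ss' : `|s' - s| <= lambda + B.
  rewrite sE ler_norml /s'.
  set u := a * i%:R - _.
  have lB : 0 < lambda + B by lra.
  by case: (leP 0 u); case: (leP 0 (u + (lambda + B))) => h1 h2; apply/andP; split; lra.
have contract : s' * psi (s' / (i%:R + 1)) <= theta * G (i, j).
  have G0 : 0 <= theta * G (i, j).
    by rewrite mulr_ge0 ?(ltW t0)//; exact: le_trans iG.
  have [u0|u0] := leP (a * i%:R - B * (j%:R + 1)) 0.
    by rewrite /s' (max_idPl _)// mul0r.
  have i_gt0 : 0 < i%:R :> R.
    rewrite lt_neqAle i0 andbT; apply/eqP => i_eq0.
    have : 0 < B * (j%:R + 1) by rewrite mulr_gt0// ltr_wpDl.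
    by move: u0; rewrite -i_eq0 mulr0; lra.
  have j1 : 0 < j%:R + 1 :> R by lra.
  have s'E : s' = a * i%:R - B * (j%:R + 1) by rewrite /s' (max_idPr _)// ltW.
  have h := psi_contract (r := i%:R / (j%:R + 1)) (y := s' / i%:R).
  have {}h : s' / i%:R * psi (s' / i%:R) <= theta * psi (i%:R / (j%:R + 1)).
    apply: h; rewrite ?divr_ge0 ?(ltW j1)//.
    rewrite le_eqVlt; apply/predU1P; left; rewrite s'E; field; rewrite !gt_eqF//.
  have : s' * psi (s' / (i%:R + 1)) <= s' * psi (s' / i%:R).
    rewrite ler_wpM2l// le_psi// ler_wpM2l// lef_pV2 ?posrE//; lra.
  move/le_trans; apply; rewrite /G/= mulrCA.
  rewrite -(ler_pM2l i_gt0) in h; apply: le_trans h.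
  by rewrite mulrA (mulrC i%:R) divfK ?gt_eqF.
(* The left side is [i + 1] times [x * psi x] at [x = n / (i + 1)], so by homogeneity the Lipschitz
   constant [k] is independent of [i]. *)
have pointwise n : n%:R * psi (n%:R / (i%:R + 1)) <=
    theta * G (i, j) + k * (lambda + B) + k * `|n%:R - s|.
  have i1 : 0 < i%:R + 1 :> R by lra.
  have := lip (n%:R / (i%:R + 1)) (s' / (i%:R + 1)).
  rewrite !divr_ge0 ?(ltW i1)// => /(_ isT isT).
  rewrite -mulrBl normrM (gtr0_norm (x := (_)^-1)) ?invr_gt0// => h.
  have {h} : n%:R * psi (n%:R / (i%:R + 1)) <=
      s' * psi (s' / (i%:R + 1)) + k * `|n%:R - s'|.
    rewrite -(ler_pM2r (x := (i%:R + 1)^-1)) ?invr_gt0//.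
    by rewrite (mulrAC n%:R) (le_trans h)//; rewrite le_eqVlt; apply/predU1P; left; ring.
  have : k * `|n%:R - s'| <= k * (`|n%:R - s| + (lambda + B)).
    rewrite ler_pM2l// (le_trans (ler_distD s _ _))// lerD2l distrC.
    by [].
  by lra.
(* AM-GM, with the weight chosen so that the variance term stays bounded *)
have amgm (t : R) : `|t| <= eta * (s + 1) + t ^+ 2 / (4 * eta * (s + 1)).
  have d0 : 0 < eta * (s + 1) by rewrite mulr_gt0.
  have -> : 4 * eta * (s + 1) = 4 * (eta * (s + 1)) by ring.
  set w := eta * (s + 1) in d0 *.
  have w4 : 0 < 4 * w by lra.
  rewrite -(real_normK (num_real t)); set u := `|t|.
  have -> : w + u ^+ 2 / (4 * w) = u + (u - 2 * w) ^+ 2 / (4 * w).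
    by field; rewrite gt_eqF.
  by rewrite lerDl divr_ge0 ?sqr_ge0// ltW.
pose D := k / (4 * eta * (s + 1)).
have D0 : 0 <= D by rewrite divr_ge0 ?(ltW k0)// !mulr_ge0 ?ltW.
pose A := theta * G (i, j) + k * (lambda + B) + k * (eta * (s + 1)) + eps * i%:R.
have G0 : 0 <= G (i, j) by exact: le_trans iG.
have A0 : 0 <= A.
  have q1 : 0 <= theta * G (i, j) by rewrite mulr_ge0// ltW.
  have q2 : 0 < k * (lambda + B) by rewrite mulr_gt0// addr_gt0.
  have q3 : 0 < k * (eta * (s + 1)) by rewrite mulr_gt0// mulr_gt0.
  have q4 : 0 <= eps * i%:R by rewrite mulr_ge0// ltW.
  by rewrite /A; lra.
apply: (le_trans (Epois_le_quadratic (A := A) (B := 0) (D := D) s0 A0 _ D0 _)) => //.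
  move=> n; rewrite mul0r addr0; apply/andP; split.
    rewrite addr_ge0 ?mulr_ge0 ?(ltW eps0) ?expR_ge0//.
  rewrite /G/= /A.
  have := pointwise n; have := amgm (n%:R - s).
  have -> : D * (n%:R - s) ^+ 2 = k * ((n%:R - s) ^+ 2 / (4 * eta * (s + 1))).
    by rewrite /D; ring.
  set e1 := `| _ |; set e2 := _ ^+ 2 / _ => h1 h2.
  have : k * e1 <= k * (eta * (s + 1) + e2) by rewrite ler_pM2l.
  by lra.
rewrite lee_fin mul0r addr0.
have Ds : D * s <= k / (4 * eta).
  have -> : D * s = k / (4 * eta) * (s / (s + 1)).
    by rewrite /D; field; rewrite !gt_eqF.
  rewrite ler_piMr ?divr_ge0 ?mulr_ge0 ?(ltW k0) ?(ltW eta0)//.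
  by rewrite ler_pdivrMr//; lra.
have Le : k * (eta * s) <= k * (eta * (a * i%:R + lambda)).
  by rewrite ler_pM2l// ler_pM2l.
have Lai : k * (eta * (a * i%:R)) = eps * i%:R by rewrite -etaE; ring.
have epsiG : eps * i%:R <= eps * G (i, j) by rewrite ler_pM2l.
have eps_j : 0 <= (1 + theta) / 2 * (eps * j%:R).
  by rewrite !mulr_ge0 ?(ltW eps0)//; lra.
rewrite /A /K [(i, j).2]/=.
have -> : (1 + theta) / 2 = theta + 2 * eps by rewrite epsE; field.
have : 0 <= (theta + 2 * eps) * (eps * j%:R) by rewrite !mulr_ge0 ?(ltW eps0)//; lra.
lra.
Qed.

End Inhibition.
Lemma bcE : bc a = if a <= 0 then 1 else if a < 2 then 1 - a else - (a ^+ 2 / 4).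
Proof. by []. Qed.

Theorem ergodic_regionR : regionR (a, b) -> geometrically_ergodic p.
Proof.
rewrite /regionR/= bcE => bbc.
have [a_lt1|a1] := ltP a 1.
  apply: ergodic_small; move: bbc; rewrite /Num.max.
  by case: ifPn; rewrite -?ltNge => ha; [|case: ifPn; rewrite -?leNgt => h2];
    case: ifP; case: ifP; rewrite -?leNgt; lra.
move: bbc; rewrite ifF; last by apply/negbTE; rewrite -ltNge; lra.
have [a2 bb|a2 bb] := ltP a 2.
  (* The polynomial [r ^+ 2 - (a + d) * r - b] must be nonnegative for [r >= 1 - d]. At [r = 1 - d]
     its value is at least [1 - a - b - 3 * d] and its slope is [2 - a - 3 * d]. *)
  pose d := Num.min (1 - a - b) (2 - a) / 3.
  have m1 : Num.min (1 - a - b) (2 - a) <= 1 - a - b by rewrite ge_min lexx.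
  have m2 : Num.min (1 - a - b) (2 - a) <= 2 - a by rewrite ge_min lexx orbT.
  have m0 : 0 < Num.min (1 - a - b) (2 - a) by rewrite lt_min; apply/andP; split; lra.
  have d0 : 0 < d by rewrite /d; lra.
  have d1 : 3 * d <= 1 - a - b by rewrite /d; lra.
  have d2 : 3 * d <= 2 - a by rewrite /d; lra.
  clearbody d.
  apply: (@ergodic_inhibition (1 - d) d) => //; [lra|lra|lra|].
  move=> r rd; rewrite expr2.
  have : 0 <= (r - (1 - d)) * (2 * (1 - d) - a - d) by rewrite mulr_ge0//; lra.
  have : 0 <= (r - (1 - d)) * (r - (1 - d)) by rewrite mulr_ge0//; lra.
  have : 0 <= d * d by rewrite mulr_ge0// ltW.
  have : 0 <= a * d by rewrite mulr_ge0//; lra.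
  have : d * d <= d * 1 by rewrite ler_pM2l//; lra.
  by lra.
have dd0 : 0 < - 4 * b - a ^+ 2 by lra.
have a0 : 0 < 2 * a + 1 by lra.
(* Now the discriminant [(a + d) ^+ 2 + 4 * b] is made nonpositive, using [d ^+ 2 <= d]; the gap
   then holds for all [r], and 1/2 is an arbitrary [theta]. *)
pose d := Num.min 1 ((- 4 * b - a ^+ 2) / (2 * a + 1)).
have d0 : 0 < d by rewrite lt_min ltr01 divr_gt0.
have d1 : d <= 1 by rewrite ge_min lexx.
have d2 : d * (2 * a + 1) <= - 4 * b - a ^+ 2.
  by rewrite -ler_pdivlMr// /d ge_min lexx orbT.
clearbody d.
apply: (@ergodic_inhibition (1 / 2) d) => //; [by have := sqr_ge0 a; lra|lra|].
move=> r _.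
have : 0 <= (2 * r - (a + d)) ^+ 2 by exact: sqr_ge0.
have : d * d <= d * 1 by rewrite ler_pM2l.
move: d2; rewrite !expr2; lra.
Qed.

End Ergodic.

(** * The transient region *)

Section Transient.
Context {R : realType}.
Variables (a b lambda : R) (hlambda : 0 < lambda).
Local Notation p := (transition a b lambda).
Local Notation rate := (rate a b lambda).

Lemma natr_ub (x : R) : exists n : nat, x <= n%:R.
Proof.
exists (Num.bound `|x|); rewrite (le_trans (ler_norm x))// ltW//.
exact: archi_boundP.
Qed.

Lemma Epois_inv_le (s m u : R) : 0 <= s -> 1 <= m -> 0 < u -> u <= s + (m - 1) ->
  (Epois s (fun k => (k%:R + m)^-1%R) <= (u^-1)%:E)%E.
Proof.
move=> s0 m1 u0 us; have := Epois_inv s0 m1.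
have : (0 <= Epois s (fun k => (k%:R + m)^-1%R))%E.
  by apply: Epois_ge0 => // k; rewrite invr_ge0 addr_ge0//; lra.
case: (Epois _ _) => [v| |]//; last first.
  by rewrite gt0_muley// lte_fin; lra.
rewrite -EFinM !lee_fin => v0 sv.
rewrite -[leRHS]mul1r ler_pdivlMr// mulrC; apply: le_trans sv.
by rewrite ler_wpM2r.
Qed.

(* Truncating [g] at the level [c] makes it superharmonic everywhere as soon as
   it is so where [g < c]. *)
Lemma transient_of_excessive (g : state -> R) (c : R) :
  0 < c -> c <= 1 -> (forall x, 0 <= g x) ->
  (forall x, g x < c ->
    (Epois (rate x) (fun k => Num.min c (g (k, x.1))) <= (g x)%:E)%E) ->
  c <= g origin -> (exists k, g (k, 0%N) < c) -> transient p.
Proof.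
move=> c0 c1 g0 gP g_origin [k gk].
pose h x := Num.min c (g x).
have h0 x : 0 <= h x by rewrite le_min (ltW c0) g0.
have hc x : h x <= c by rewrite ge_min lexx.
have sp := transition_stochastic a b lambda.
apply: (@transient_of_superharmonic _ _ h origin) => //.
- by move=> x; rewrite h0 (le_trans (hc x)).
- move=> x; have [gc|cg] := ltP (g x) c.
    by rewrite kop_transition// /h [in leRHS]/Num.min ltNge (ltW gc)/= gP.
  rewrite {2}/h (min_idPl cg); apply: (mop_le_cst (kop_markov sp)).
  + exact: ltW.
  + by move=> y; rewrite lee_fin.
  + by move=> y; rewrite lee_fin.
- rewrite {2}/h (min_idPl g_origin) kop_transition//.
  rewrite (_ : Defs.rate _ _ _ _ = lambda); last first.
    by rewrite /Defs.rate/= !mulr0 !add0r; apply/max_idPr/ltW.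
  have l0 := ltW hlambda.
  (* At the origin [h] has its maximal value [c]. The draw [k] has positive probability because
     [lambda > 0], and it leads to a state where [h] is smaller by [d]. *)
  pose d := c - h (k, 0%N).
  have d0 : 0 < d by rewrite subr_gt0 /h gt_min gk orbT.
  pose f j : R := d * (j == k)%:R.
  have f0 j : 0 <= f j by rewrite mulr_ge0// ltW.
  have le_c : (Epois lambda (fun j => h (j, 0%N)) + Epois lambda f <= c%:E)%E.
    rewrite -EpoisD// -(Epois_cst c l0); apply: le_Epois => // j.
      by rewrite addr_ge0.
    rewrite /f; have [->|_] := eqVneq j k; first by rewrite mulr1 /d; lra.
    by rewrite mulr0 addr0.
  have fk : (0 < Epois lambda f)%E.
    rewrite /Epois (nneseriesD1 (n := k))//; last first.
      by move=> j _; rewrite lee_fin mulr_ge0// pois_ge0.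
    apply: (@lt_le_trans _ _ (pois lambda k * f k)%:E); last first.
      rewrite leeDl//; apply: nneseries_ge0 => j _ _.
      by rewrite lee_fin mulr_ge0// pois_ge0.
    rewrite lte_fin /f eqxx mulr1 mulr_gt0// /pois.
    by rewrite divr_gt0 ?ltr0n ?fact_gt0// mulr_gt0 ?expR_gt0// exprn_gt0.
  have E0 : (0 <= Epois lambda (fun j => h (j, 0%N)))%E by exact: Epois_ge0.
  move: le_c fk E0; case: (Epois _ _) => [u| |]//; case: (Epois _ _) => [v| |]//.
  by rewrite -EFinD !lte_fin !lee_fin => ? ? ?; lra.
- move=> y; apply: lt_le_trans (origin_minorization a b lambda y).
  by rewrite lte_fin expR_gt0.
Qed.

Lemma rate_ge x : a * x.1%:R + b * x.2%:R + lambda <= rate x.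
Proof. by rewrite /Defs.rate le_max lexx orbT. Qed.

Lemma transient_excitation (nu rho : R) : 0 <= nu -> 0 < rho ->
  (forall u v, 0 <= u -> 0 <= v ->
    rho * (u + nu * v) <= (a + nu - 1) * u + (b - nu) * v) ->
  transient p.
Proof.
move=> nu0 rho0 growth; have l0 := hlambda.
have rV0 : 0 < rho^-1 by rewrite invr_gt0.
(* [i + nu j] grows in mean by the factor [1 + rho] *)
pose g (x : state) := (x.1%:R + nu * x.2%:R + 2)^-1.
have g0 x : 0 <= g x by rewrite invr_ge0 !addr_ge0// mulr_ge0.
(* The level [c] confines attention to [i + nu * j > rho^-1], where the mean gain exceeds 1, the
   amount lost in the bound for the inverse moment. *)
apply: (@transient_of_excessive g (rho^-1 + 2)^-1) => //.
- by rewrite invr_gt0; lra.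
- by rewrite invf_le1; lra.
- move=> [i j]; rewrite /g/= => gc.
  have i0 : 0 <= i%:R :> R by []. have j0 : 0 <= j%:R :> R by [].
  have ni0 : 0 <= nu * i%:R by rewrite mulr_ge0.
  have nj0 : 0 <= nu * j%:R by rewrite mulr_ge0.
  have : rho^-1 < i%:R + nu * j%:R.
    by move: gc; rewrite ltf_pV2 ?posrE; lra.
  rewrite -(ltr_pM2l rho0) mulfV ?gt_eqF// => u1.
  have s0 := rate_ge0 a b lambda (i, j); have /= sge := rate_ge (i, j).
  apply: (@le_trans _ _ (Epois (rate (i, j)) (fun k => (k%:R + (nu * i%:R + 2))^-1))).
    apply: le_Epois => // k.
      by rewrite le_min !invr_ge0 !addr_ge0// ?mulr_ge0//; lra.
    by rewrite ge_min (addrA k%:R) lexx orbT.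
  apply: Epois_inv_le => //; first lra.
    by lra.
  by have := growth _ _ i0 j0; lra.
- by rewrite /g /origin/= mulr0 !add0r lef_pV2 ?posrE; lra.
- have [n hn] := natr_ub (rho^-1 + 1); exists n.
  by rewrite /g/= mulr0 addr0 ltf_pV2 ?posrE; lra.
Qed.

Lemma transient_alternating : a < 0 -> 1 < b -> transient p.
Proof.
move=> a0 b1; have l0 := hlambda.
have [n1 hn1] := natr_ub (b - 1)^-1; have [n2 hn2] := natr_ub (lambda / - a).
(* Beyond [n], the mean [b * j] from [(0, j)] is at least [j + 1], and the rate at [(i, 0)] is 0. *)
pose n := (n1 + n2)%N.
have n_b (j : nat) : (n <= j)%N -> 1 <= (b - 1) * j%:R.
  move=> nj; rewrite mulrC -ler_pdivrMr ?subr_gt0// div1r.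
  by rewrite (le_trans hn1)// ler_nat (leq_trans _ nj)// leq_addr.
have n_a (i : nat) : (n <= i)%N -> a * i%:R + lambda <= 0.
  move=> ni; have : lambda / - a <= i%:R.
    by rewrite (le_trans hn2)// ler_nat (leq_trans _ ni)// leq_addl.
  by rewrite ler_pdivrMr; lra.
(* the chain alternates between (k, 0) and (0, k), multiplying k by about b *)
pose g (x : state) : R :=
  if (x.1 == 0%N) || (x.2 == 0%N) then (x.1%:R + x.2%:R + 1)^-1 else 1.
have g0 x : 0 <= g x by rewrite /g; case: ifP => // _; rewrite invr_ge0 !addr_ge0.
have n0 : 0 <= n%:R :> R by [].
pose c : R := (n%:R + 1)^-1.
have c0 : 0 < c by rewrite invr_gt0; lra.
have c1 : c <= 1 by rewrite invf_le1; lra.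
have minc0 y : 0 <= Num.min c (g y) by rewrite le_min (ltW c0) g0.
apply: (@transient_of_excessive g c) => //.
- move=> [i j]; rewrite {1}/g/=; case: ifP => [ij|_ c1']; last first.
    by move: c1' c1; rewrite ltNge => /negbTE ->.
  have s0 := rate_ge0 a b lambda (i, j).
  have i0 : 0 <= i%:R :> R by []. have j0 : 0 <= j%:R :> R by [].
  rewrite ltf_pV2 ?posrE; [|lra|lra].
  rewrite -natrD ltrD2r ltr_nat => nij; rewrite /g/= ij.
  move: (ij) => /orP[/eqP ie|/eqP je].
    have sge := rate_ge (i, j); subst i; move: nij; rewrite add0n => nj.
    have bj := n_b _ (ltnW nj).
    apply: (@le_trans _ _ (Epois (rate (0%N, j)) (fun k => (k%:R + 1)^-1))).
      apply: le_Epois => // k.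
        exact: (minc0 (k, 0%N)).
      by rewrite eqxx orbT addr0 ge_min lexx orbT.
    by apply: Epois_inv_le => //; move: sge => /=; lra.
  subst j; move: nij; rewrite addn0 => ni.
  have -> : rate (i, 0%N) = 0.
    by rewrite /Defs.rate/= mulr0 addr0; apply/max_idPl/n_a/ltnW.
  (* At rate 0 only the draw [k = 0] counts. The term [k ^+ 2], of mean 0, dominates the integrand
     for all other [k], since [c <= 1]. *)
  apply: (le_trans (Epois_le_quadratic (A := (i%:R + 1)^-1) (B := 0) (D := 1)
    (lexx 0) _ _ _ _)) => //.
    move=> k; rewrite (minc0 (k, i))/= mul0r addr0 mul1r subr0.
    have inv0 : 0 <= (i%:R + 1)^-1 :> R by rewrite invr_ge0; lra.
    have [->/=|k0] := eqVneq k 0%N.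
      by rewrite add0r expr0n addr0 ge_min lexx orbT.
    have k1 : 1 <= k%:R ^+ 2 :> R by rewrite exprn_ege1// ler1n lt0n.
    by rewrite ge_min; apply/orP; left; lra.
  by rewrite lee_fin !mulr0 !addr0.
- by rewrite /g /origin/= !add0r invr1.
- exists n.+1; rewrite /g/= addr0 ltf_pV2 ?posrE -?natr1; lra.
Qed.

Lemma transient_cone (alpha : R) : b < 0 -> 1 <= alpha ->
  alpha ^+ 2 < a * alpha + b -> transient p.
Proof.
move=> b0 alpha1 gap; have l0 := hlambda.
have alpha0 : 0 < alpha by lra.
pose r := a + b / alpha.
have r_alpha : r * alpha = a * alpha + b by rewrite /r mulrDl divfK// gt_eqF.
have r_gt : alpha < r by rewrite -(ltr_pM2r alpha0) r_alpha -expr2.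
have r1 : 1 < r by lra.
have r0 : 0 < r by lra.
pose k := 1 - alpha / r.
have kr : k * r = r - alpha by rewrite /k mulrBl mul1r divfK// gt_eqF.
have k0 : 0 < k by rewrite -(pmulr_lgt0 _ r0) kr; lra.
(* [n2] makes the cost of leaving the cone at most [(r - 1) / 2 * s^-1], so that the total is at
   most [(1 + r) / 2 * s^-1]; [n1] makes this at most [(i + 1)^-1] when [s >= r * i]. *)
have [n1 hn1] := natr_ub ((1 + r) / (r - 1)).
have [n2 hn2] := natr_ub (2 / (k ^+ 2 * (r - 1))).
pose n := (n1 + n2)%N.
have n0 : 0 <= n%:R :> R by [].
pose c : R := (n%:R + 1)^-1.
have c0 : 0 < c by rewrite invr_gt0; lra.
have c1 : c <= 1 by rewrite invf_le1; lra.
have k20 : 0 < k ^+ 2 by rewrite exprn_gt0.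
have ck : c / k ^+ 2 <= (r - 1) / 2.
  rewrite ler_pdivrMr// -[leRHS]invrK lef_pV2 ?posrE; last 2 first.
  - by lra.
  - by rewrite invr_gt0 mulr_gt0//; lra.
  have -> : ((r - 1) / 2 * k ^+ 2)^-1 = 2 / (k ^+ 2 * (r - 1)).
    by rewrite !invfM invrK; ring.
  rewrite (le_trans hn2)//; have : (n2%:R <= n%:R :> R) by rewrite ler_nat leq_addl.
  by lra.
(* the cone i >= alpha j is mapped in mean into its interior, i being multiplied
   by at least r > 1 *)
pose g (x : state) : R :=
  if alpha * x.2%:R <= x.1%:R then (x.1%:R + 1)^-1 else 1.
have g0 x : 0 <= g x by rewrite /g; case: ifP => // _; rewrite invr_ge0 addr_ge0.
apply: (@transient_of_excessive g c) => //.
- move=> [i j]; rewrite {1}/g/=; case: ifP => [ij|_ c1']; last first.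
    by move: c1' c1; rewrite ltNge => /negbTE ->.
  have s0 := rate_ge0 a b lambda (i, j); have /= sge := rate_ge (i, j).
  have i0 : 0 <= i%:R :> R by []. have j0 : 0 <= j%:R :> R by [].
  rewrite ltf_pV2 ?posrE; [|lra|lra].
  rewrite ltrD2r ltr_nat => ni; rewrite /g/= ij.
  set s := rate _ in s0 sge *.
  have i1 : 1 <= i%:R :> R by rewrite ler1n (leq_trans _ ni).
  have sr : r * i%:R <= s.
    apply: le_trans sge; rewrite /r mulrDl -addrA lerD2l.
    have : b / alpha * i%:R <= b / alpha * (alpha * j%:R).
      by rewrite ler_wnM2l// ltW// pmulr_llt0// invr_gt0.
    by rewrite mulrA divfK ?gt_eqF//; lra.
  have s_gt0 : 0 < s by apply: lt_le_trans sr; rewrite mulr_gt0//; lra.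
  have sk : k * s <= s - alpha * i%:R.
    have : alpha / r * (r * i%:R) <= alpha / r * s.
      by rewrite ler_wpM2l// divr_ge0// ltW.
    by rewrite mulrA divfK ?gt_eqF// /k; lra.
  have sa0 : 0 < s - alpha * i%:R by apply: lt_le_trans sk; rewrite mulr_gt0.
  (* Chebyshev's inequality: outside the cone, where [m < alpha * i], the quadratic term is at least
     [c]. Its mean is of order [s^-1], as the distance from [s] to the boundary is at least
     [k * s]. *)
  pose D := c / (s - alpha * i%:R) ^+ 2.
  have D0 : 0 <= D by rewrite divr_ge0 ?(ltW c0)// sqr_ge0.
  apply: (@le_trans _ _ (Epois s (fun m => (m%:R + 1)^-1 + D * (m%:R - s) ^+ 2))).
    apply: le_Epois => // m.
      by rewrite le_min (ltW c0); exact: (g0 (m, i)).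
    have D0' : 0 <= D * (m%:R - s) ^+ 2 by rewrite mulr_ge0// sqr_ge0.
    have m0 : 0 <= (m%:R + 1)^-1 :> R by rewrite invr_ge0 addr_ge0.
    rewrite ge_min; case: (leP (alpha * i%:R) m%:R) => mi.
      by apply/orP; right; lra.
    apply/orP; left.
    have : c <= D * (m%:R - s) ^+ 2.
      rewrite /D mulrAC ler_pdivlMr ?exprn_gt0// ler_pM2l//.
      rewrite -[leRHS]sqrrN opprB ler_sqr ?nnegrE; lra.
    by lra.
  rewrite EpoisD//; last by move=> m; rewrite mulr_ge0// sqr_ge0.
  rewrite EpoisZ//; last by move=> m; exact: sqr_ge0.
  rewrite Epois_variance//.
  have E1 : (Epois s (fun m => (m%:R + 1)^-1%R) <= (s^-1)%:E)%E.
    by apply: Epois_inv_le => //; lra.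
  apply: (le_trans (leeD2r _ E1)); rewrite -EFinM -EFinD lee_fin.
  have Ds : D * s <= c / k ^+ 2 * s^-1.
    have -> : c / k ^+ 2 * s^-1 = c / (k * s) ^+ 2 * s.
      by field; rewrite !gt_eqF.
    have ks0 : 0 < k * s by rewrite mulr_gt0.
    rewrite ler_wpM2r// /D ler_pM2l// lef_pV2 ?posrE ?exprn_gt0//.
    by rewrite ler_sqr ?nnegrE ?(ltW sa0) ?(ltW ks0).
  have sV0 : 0 <= s^-1 by rewrite invr_ge0 ltW.
  have h1 : c / k ^+ 2 * s^-1 <= (r - 1) / 2 * s^-1 by rewrite ler_wpM2r.
  apply: (@le_trans _ _ ((1 + r) / 2 * s^-1)); first by lra.
  rewrite ler_pdivrMr// (mulrC _ s) ler_pdivlMr; last by lra.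
  apply: le_trans sr.
  have h2 : 1 + r <= (r - 1) * i%:R.
    rewrite mulrC -ler_pdivrMr ?subr_gt0// (le_trans hn1)// ler_nat.
    by rewrite (leq_trans _ (ltnW ni))// leq_addr.
  by lra.
- by rewrite /g /origin/= mulr0 lexx add0r invr1.
- exists n.+1; rewrite /g/= mulr0 ler0n ltf_pV2 ?posrE -?natr1; lra.
Qed.

Theorem transient_regionT : regionT (a, b) -> transient p.
Proof.
rewrite /regionT/= /bc => bcb.
have [b0|b0] := ltP b 0.
  have a0 : 1 < a by move: bcb; case: ifPn => ha; [|case: ifPn; rewrite -?leNgt => h2]; lra.
  move: bcb; rewrite ifF; last by apply/negbTE; rewrite -ltNge; lra.
  (* In each case [alpha] is the maximizer of [a * alpha - alpha ^+ 2] over [alpha >= 1]. *)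
  have [a2 bb|a2 bb] := ltP a 2.
    by apply: (@transient_cone 1) => //; rewrite expr1n; lra.
  apply: (@transient_cone (a / 2)) => //; first lra.
  by rewrite !expr2 in bb *; lra.
have [a0|a0] := ltP a 0.
  by apply: transient_alternating => //; move: bcb; rewrite ltW.
have ab : 1 < a + b.
  move: bcb; case: ifPn => ha; first lra.
  by case: ifPn; rewrite -?leNgt; lra.
have [a1|a1] := ltP 1 a.
  apply: (@transient_excitation 0 (a - 1)); rewrite ?subr_gt0// => u v u0 v0.
  have : 0 <= b * v by rewrite mulr_ge0.
  by lra.
(* This [nu] equates the coefficients [a + nu - 1] and [b - nu]; it is nonnegative since here
   [a <= 1] and [b >= 0]. *)
pose nu := (1 - a + b) / 2; pose k := (a + b - 1) / 2.
have nu0 : 0 <= nu by rewrite /nu; lra.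
have k0 : 0 < k by rewrite /k; lra.
have nu1 : 0 < 1 + nu by lra.
apply: (@transient_excitation nu (k / (1 + nu))) => //; first exact: divr_gt0.
move=> u v u0 v0.
have -> : a + nu - 1 = k by rewrite /nu /k; lra.
have -> : b - nu = k by rewrite /nu /k; lra.
rewrite mulrAC ler_pdivrMr//.
have h : u + nu * v <= (u + v) * (1 + nu).
  by have : 0 <= nu * u by [rewrite mulr_ge0]; lra.
by have := ler_wpM2l (ltW k0) h; lra.
Qed.

End Transient.

Theorem theorem2 (R : realType) (a b lambda : R) (hlambda : 0 < lambda) :
  (regionR (a, b) -> geometrically_ergodic (transition a b lambda)) /\
  (regionT (a, b) -> transient (transition a b lambda)).
Proof. by split; [exact: ergodic_regionR|exact: transient_regionT]. Qed.
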